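(* Let $x^*$ be a local optimal solution of problem (P), and suppose $\nabla^2\varphi(x)\succeq 0$ for all $x$ in an open neighborhood $\mathcal{N}^*\subset\mathcal{O}$ of $x^*$. Let $v^*:=-\nabla\varphi(x^* )$ and $X^*:=g(x^* )$. Suppose that the multifunction $\mathcal{G}$ is metrically regular at $(x^*,(0,0))$. Pick any $(y^*,S^* )\in\arg\min_{(y,S)\in\mathcal{M}(x^*,v^* )}\operatorname{rank}(S)$, and let $\alpha^*,\beta^*,\gamma^*$ and $\alpha_1,\ldots,\alpha_p$ be the index sets associated with $(X,S)=(X^*,S^* )$. Let $\Upsilon$ be the set of all $w\in\mathbb{X}$ for which there exist index sets $\beta_-^*,\beta_+^*,\beta_0^*,\widetilde{\gamma}^*\subset[n]$ with $\gamma^*\subset\widetilde\gamma^*$, a matrix $P^*\in\mathbb{O}(X^* )\cap\mathbb{O}(S^* )$ and a block diagonal matrix $Q=\mathrm{BlkDiag}(Q_1,\ldots,Q_p)$ with $Q_j\in\mathbb{O}^{|\alpha_j|}$ such that $$\beta^*=\beta_-^*\cup\beta_+^*\cup\beta_0^*\cup[\widetilde\gamma^*\setminus\gamma^*],\quad \widetilde W_{[\alpha^*\cup\beta_+^*]\widetilde\gamma^*}=0,\quad \widetilde W_{\beta_0^*\beta_0^*}\succeq 0,\quad \widetilde W_{[\beta_0^*\cup\beta_-^*\cup\widetilde\gamma^*][\beta_-^*\cup\widetilde\gamma^*]}=0,$$ where $\widetilde W:=(P^*Q)^\top(g'(x^* )w)P^*Q$. If $$\operatorname{Ker}\nabla^2\varphi(x^*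 )\cap\operatorname{Ker}\mathcal{A}\cap[\![v^*]\!]^\perp\cap\Upsilon=\{0\},$$ then $x^*$ is a tilt-stable solution of problem (P).
   Context: $\mathbb{X}$ is a finite-dimensional real Euclidean space with inner product $\langle\cdot,\cdot\rangle$; $\mathbb{S}^n$ is the space of real symmetric $n\times n$ matrices with the trace inner product and Frobenius norm; $\mathbb{S}^n_+$ is the cone of positive semidefinite matrices, $\mathbb{S}^n_-=-\mathbb{S}^n_+$; $\mathbb{O}^k$ is the set of $k\times k$ real orthogonal matrices; $[n]=\{1,\ldots,n\}$; $\mathbb{B}(x,\delta)$ is the closed ball; $[\![v]\!]^\perp$ is the orthogonal complement of the span of $v$. Problem (P): $\min_{x\in\mathbb{X}}\{\varphi(x):\ \mathcal{A}x=b,\ g(x)\in\mathbb{S}^n_+\}$, with feasible set $\Gamma:=\mathcal{A}^{-1}(b)\cap g^{-1}(\mathbb{S}^n_+)$. Here $\varphi:\mathbb{X}\to(-\infty,\infty]$ is proper, lower semicontinuous and twice continuously differentiable on an open set $\mathcal{O}\supset\Gamma$; $\mathcal{A}:\mathbb{X}\to\mathbb{R}^m$ is linear, $b\in\mathbb{R}^m$; $g:\mathbb{X}\to\mathbb{S}^n$ is twice continuously differentiable and $\mathbb{S}^n_-$-convex, i.e. $x\mapsto\langle S,g(x)\rangle$ is convex for every $S\in\mathbb{S}^n_-$ (so $\Gamma$ is convex). $g'(x):\mathbb{X}\to\mathbb{S}^n$ is the differential of $g$ at $x$ and $\nabla g(x):\mathbb{S}^n\to\mathbb{X}$ is its adjoint;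 $\mathcal{A}^*$ is the adjoint of $\mathcal{A}$. Tilt stability: for $f:\mathbb{X}\to(-\infty,\infty]$ proper, $\bar x\in\mathrm{dom}\,f$ is a tilt-stable local minimum of $f$ if there is $\delta>0$ such that $M_\delta(v):=\arg\min_{x\in\mathbb{B}(\bar x,\delta)}\{f(x)-f(\bar x)-\langle v,x-\bar x\rangle\}$ is single-valued and Lipschitz continuous on some neighborhood of $v=0$ with $M_\delta(0)=\{\bar x\}$. ''$x^*$ is a tilt-stable solution of (P)'' means that $x^*$ is a tilt-stable local minimum of $\varphi+\delta_\Gamma$, $\delta_\Gamma$ the indicator function of $\Gamma$. Metric regularity: $\mathcal{F}:\mathbb{X}\rightrightarrows\mathbb{Z}$ is metrically regular at $(x,z)\in\mathrm{gph}\,\mathcal{F}$ if there are $\delta,\kappa>0$ with $\mathrm{dist}(x',\mathcal{F}^{-1}(z'))\le\kappa\,\mathrm{dist}(z',\mathcal{F}(x'))$ for all $(x',z')\in\mathbb{B}((x,z),\delta)$. The multifunction $\mathcal{G}:\mathbb{X}\rightrightarrows\mathbb{R}^m\times\mathbb{S}^n$ is $\mathcal{G}(z):=(\mathcal{A}z-b,\,g(z))-\{0\}^m\times\mathbb{S}^n_+$. Normal cones are those of convex analysis: $\mathcal{N}_\Omega(x)=\{v:\langle v,x'-x\rangle\le0\ \forall x'\in\Omega\}$. Multipliers: $\mathcal{M}(x,v):=\{(y,S)\in\mathbb{R}^m\times\mathcal{N}_{\mathbb{S}^n_+}(g(x)):\mathcal{A}^*y+\nabla g(x)S=v\}$ if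 $v\in\mathcal{N}_\Gamma(x)$, and $\mathcal{M}(x,v):=\emptyset$ otherwise. Spectral notation: $\lambda_1(X)\ge\cdots\ge\lambda_n(X)$ are the eigenvalues of $X\in\mathbb{S}^n$, $\lambda(X)=(\lambda_1(X),\ldots,\lambda_n(X))^\top$, $\mathbb{O}(X):=\{P\in\mathbb{O}^n: X=P\,\mathrm{Diag}(\lambda(X))P^\top\}$. For $X\in\mathbb{S}^n_+$, $S\in\mathcal{N}_{\mathbb{S}^n_+}(X)$, the distinct eigenvalues of $X$ are denoted $\mu_1>\cdots>\mu_p=0$ (the class for $\mu_p=0$ being empty if $X$ is nonsingular), and $\alpha_j:=\{i\in[n]:\lambda_i(X)=\mu_j\}$ for $j\in[p]$; $\alpha:=\{i:\lambda_i(X)>0\}$, $\beta:=\{i:\lambda_i(X)=0=\lambda_i(S)\}$, $\gamma:=\{i:\lambda_i(S)<0\}$; $\alpha^*,\beta^*,\gamma^*$ are these sets for $(X^*,S^* )$. For a matrix $M$, $M_{J_1J_2}$ is the submatrix with row indices $J_1$ and column indices $J_2$. *)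

(* Defs.v *)
From HB Require Import structures.
From mathcomp Require Import all_boot all_order all_algebra sesquilinear.
From mathcomp Require Import all_classical all_reals all_analysis.

Set Implicit Arguments.
Unset Strict Implicit.
Unset Printing Implicit Defensive.

Import Order.TTheory GRing.Theory Num.Theory.
Import numFieldNormedType.Exports.

Local Open Scope classical_set_scope.
Local Open Scope ring_scope.

(* Finite-dimensional real Euclidean spaces: the norm of the normedModType
   structure is the one induced by the inner product. *)
HB.mixin Record NormedModule_hasInner (R : realType) V & NormedModule R V := {
  inner : {dot V for (@idfun R)} ;
  normr_inner : forall x : V, `|x| = Num.sqrt (inner x x)
}.

#[short(type="euclideanType")]
HB.structure Definition Euclidean (R : realType) :=
  {V of Vector R V & NormedModule R V & NormedModule_hasInner R V}.

Section Matrices.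
Context {R : realType}.

(* Trace inner product; on column vectors it is the usual dot product. *)
Definition mxinner p q (A B : 'M[R]_(p, q)) : R := \tr (A^T *m B).

Definition Splus n : set 'M[R]_n :=
  [set M | M \is symmetricmx /\ forall u : 'cV[R]_n, 0 <= (u^T *m M *m u) 0 0].

Definition Sminus n : set 'M[R]_n := [set M | Splus (- M)].

(* Normal cone to Splus in the space of symmetric matrices. *)
Definition normal_Splus n (M : 'M[R]_n) : set 'M[R]_n :=
  [set S | S \is symmetricmx /\
           forall M', Splus M' -> mxinner S (M' - M) <= 0].

Definition orthogonalmx n : set 'M[R]_n := [set P | P^T *m P = 1%:M].

(* M_{J1 J2}; enum_val lists the elements of an index set increasingly. *)
Definition mxblk n (M : 'M[R]_n) (J1 J2 : {set 'I_n}) : 'M[R]_(#|J1|, #|J2|) :=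
  mxsub (fun i => enum_val i) (fun j => enum_val j) M.

(* Eigenvalues with multiplicity, in nonincreasing order. This vector is unique
   if it exists, and it exists for every symmetric matrix. *)
Definition eigvals n (M : 'M[R]_n) : 'rV[R]_n :=
  get [set l : 'rV[R]_n |
    (forall i j : 'I_n, (i <= j)%N -> l 0 j <= l 0 i) /\
    char_poly M = \prod_(i < n) ('X - (l 0 i)%:P)].

Definition eigenbases n (M : 'M[R]_n) : set 'M[R]_n :=
  [set P | orthogonalmx P /\ M = P *m diag_mx (eigvals M) *m P^T].

Section Spectral.
Variables (n : nat) (M S : 'M[R]_n).

Definition alpha_idx : {set 'I_n} := [set i | 0 < eigvals M 0 i]%SET.
Definition beta_idx : {set 'I_n} :=
  [set i | (eigvals M 0 i == 0) && (eigvals S 0 i == 0)]%SET.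
Definition gamma_idx : {set 'I_n} := [set i | eigvals S 0 i < 0]%SET.

(* mu_1 > ... > mu_p: for positive semidefinite M, the last one is mu_p = 0,
   and it is listed even if M is nonsingular. *)
Definition distinct_eigvals : seq R :=
  sort (fun a b => b <= a) (undup (0 :: [seq eigvals M 0 i | i <- enum 'I_n])).

Definition eig_class (j : 'I_(size distinct_eigvals)) : {set 'I_n} :=
  [set i | eigvals M 0 i == distinct_eigvals`_j]%SET.

(* Q = BlkDiag(Q_1, ..., Q_p), each Q_j orthogonal. *)
Definition block_orthogonal : set 'M[R]_n := [set Q |
  exists Qs : forall j, 'M[R]_(#|eig_class j|),
    [/\ forall j, orthogonalmx (Qs j),
        forall j, mxblk Q (eig_class j) (eig_class j) = Qs j
      & forall j k, j != k -> mxblk Q (eig_class j) (eig_class k) = 0]].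

End Spectral.
End Matrices.

Section Calculus.
Context {R : realType} {X : euclideanType R}.

Definition riesz (l : X -> R) : X := get [set v | forall x, l x = inner v x].

Definition adjoint p q (L : X -> 'M[R]_(p, q)) (Y : 'M[R]_(p, q)) : X :=
  riesz (fun x => mxinner Y (L x)).

Definition gradient (f : X -> R) (x : X) : X := riesz ('d f x).

Definition hessian (f : X -> R) (x : X) : X -> X := 'd (gradient f) x.

(* X being finite-dimensional, continuity of the second differential is
   equivalent to its continuity at each pair of directions. *)
Definition C2_on (W : normedModType R) (O : set X) (f : X -> W) : Prop :=
  [/\ forall x, O x -> differentiable f x,
      forall u x, O x -> differentiable (fun y => 'd f y u) x
    & forall u w x, O x ->
        {for x, continuous (fun y => 'd (fun z => 'd f z u) y w)}].

Definition proper_fun (f : X -> \bar R) : Prop :=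
  (forall x, f x != -oo%E) /\ exists x, (f x < +oo)%E.

Definition set_indicator (Om : set X) (x : X) : \bar R :=
  if x \in Om then 0%E else +oo%E.

Definition normal_cone (Om : set X) (x : X) : set X :=
  [set v | forall x', Om x' -> inner v (x' - x) <= 0].

(* Infimum over the empty set is +oo. *)
Definition edistance (V : zmodType) (nrm : V -> R) (z : V) (C : set V) : \bar R :=
  ereal_inf [set (nrm (z - c))%:E | c in C].

(* The range space is the subspace D of Z, normed by nrm. *)
Definition metrically_regular (Z : zmodType) (nrm : Z -> R) (D : set Z)
    (F : X -> set Z) (x : X) (z : Z) : Prop :=
  F x z /\
  exists delta kappa : R, [/\ 0 < delta, 0 < kappa &
    forall x' z', D z' ->
      Num.sqrt (`|x' - x| ^+ 2 + nrm (z' - z) ^+ 2) <= delta ->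
      (edistance (fun u : X => `|u|%R) x' [set u | F u z']
        <= kappa%:E * edistance nrm z' (F x'))%E].

Definition tilted_argmin (f : X -> \bar R) (xb : X) (delta : R) (v : X) : set X :=
  let h x := (f x - f xb - (inner v (x - xb))%:E)%E in
  [set x | closed_ball xb delta x /\
           forall z, closed_ball xb delta z -> (h x <= h z)%E].

Definition tilt_stable (f : X -> \bar R) (xb : X) : Prop :=
  [/\ proper_fun f, (f xb < +oo)%E &
    exists delta : R, [/\ 0 < delta,
      tilted_argmin f xb delta 0 = [set xb] &
      exists (U : set X) (M : X -> X) (k : R),
        [/\ nbhs (0 : X) U,
            forall v, U v -> tilted_argmin f xb delta v = [set M v]
          & k.-lipschitz_U M]]].

End Calculus.

Section Problem.
Context {R : realType} {X : euclideanType R} {m n : nat}.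
Variables (phi : X -> \bar R) (A : {linear X -> 'cV[R]_m}) (b : 'cV[R]_m).
Variable g : X -> 'M[R]_n.

Definition feasible : set X := [set x | A x = b /\ Splus (g x)].

Definition local_solution (x : X) : Prop :=
  feasible x /\ \forall z \near x, feasible z -> (phi x <= phi z)%E.

Definition Sminus_convex : Prop :=
  forall S, Sminus S ->
    @convex_function R X [set: _] (fun x => mxinner S (g x)).

(* The product space R^m x S^n with its Euclidean norm. *)
Definition range_space : set ('cV[R]_m * 'M[R]_n) :=
  [set z | z.2 \is symmetricmx].

Definition range_norm (z : 'cV[R]_m * 'M[R]_n) : R :=
  Num.sqrt (mxinner z.1 z.1 + mxinner z.2 z.2).

Definition constraint_map (x : X) : set ('cV[R]_m * 'M[R]_n) :=
  [set (A x - b, g x) - (0, Y) | Y in Splus (n := n)].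

Definition multipliers (x v : X) : set ('cV[R]_m * 'M[R]_n) :=
  [set yS | [/\ normal_cone feasible x v, normal_Splus (g x) yS.2
              & adjoint A yS.1 + adjoint ('d g x) yS.2 = v]].

Definition min_rank_multiplier (x v : X) (y : 'cV[R]_m) (S : 'M[R]_n) : Prop :=
  multipliers x v (y, S) /\
  forall y' S', multipliers x v (y', S') -> (\rank S <= \rank S')%N.

Definition Upsilon (x : X) (S : 'M[R]_n) : set X := [set w |
  let alpha := alpha_idx (g x) in
  let beta := beta_idx (g x) S in
  let gamma := gamma_idx S in
  exists (bm bp b0 gt : {set 'I_n}) (P Q : 'M[R]_n),
    let W := (P *m Q)^T *m ('d g x w) *m (P *m Q) in
    [/\ (gamma \subset gt)%SET,
        eigenbases (g x) P /\ eigenbases S P,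
        block_orthogonal (g x) Q &
    [/\ beta = (bm :|: bp :|: b0 :|: (gt :\: gamma))%SET,
        mxblk W (alpha :|: bp)%SET gt = 0,
        Splus (mxblk W b0 b0)
      & mxblk W (b0 :|: bm :|: gt)%SET (bm :|: gt)%SET = 0]]].

End Problem.

(* Main.v *)
From HB Require Import structures.
Require Import Defs.
From mathcomp Require Import all_boot all_order all_algebra sesquilinear.
From mathcomp Require Import all_classical all_reals all_analysis.
From mathcomp Require Import ring lra.

Set Implicit Arguments.
Unset Strict Implicit.
Unset Printing Implicit Defensive.

Import Order.TTheory GRing.Theory Num.Theory.
Import numFieldNormedType.Exports.
Import VectorInternalTheory.

Local Open Scope classical_set_scope.
Local Open Scope ring_scope.

(** Upsilon is larger than it looks. Its conditions only ask that g'(xs) w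
    annihilate r independent vectors of the kernel of g xs, where r is the least
    rank of a multiplier matrix (in_Upsilon). So by hypothesis no nonzero
    w satisfies hessian w = 0, A w = 0, <vs, w> = 0 and (g'(xs) w) S = 0 for some
    multiplier (y, S) at xs, because every such S has rank at least r and its
    range lies in the kernel of g xs.

    Tilt stability follows from a Lipschitz estimate: if v1 - gradient x1 and
    v2 - gradient x2 are normal to the feasible set at points x1, x2 near xs,
    with v1 and v2 small, then |x1 - x2| <= L |v1 - v2| (strong_monotonicity).
    Indeed minimizers of the tilted problems are stationary, phi is convex near
    xs and the feasible set is convex
    (tilt_stable_of_strong_monotonicity).

    If the estimate fails, there are sequences with v1 - v2 = o(t), where
    t = |x1 - x2|, and the normalized difference (x1 - x2) / t has a limit w of
    norm 1 (bad_direction). The pairing of v1 - v2 with x1 - x2 is o(t^2) and is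
    the sum of the pairings of the gradients and of the normals, both
    nonnegative. The first gives <hessian w, w> = 0, hence hessian w = 0 by
    symmetry and positivity (psd_kernel). For the second, metric regularity
    yields bounded multipliers (y1, S1) of the normals at x1
    (multiplier_bound), and concavity of g with respect to the semidefinite
    order shows that the trace of (- S1) (g x2) is o(t^2). Both factors being
    positive semidefinite, (g x2) S1 = o(t) (psd_mul_le); as (g x1) S1 = 0, the
    limit S of S1 is a multiplier matrix at xs with (g'(xs) w) S = 0. This
    contradicts the kernel condition. *)

(** * Euclidean spaces *)

Section Euclid.
Context {R : realType} {X : euclideanType R}.
Implicit Types x y z u v : X.

Lemma innerC x y : inner x y = inner y x.
Proof. by rewrite hermC /= expr0 mul1r. Qed.

Lemma innerDr z x y : inner z (x + y) = inner z x + inner z y.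
Proof. by rewrite raddfD. Qed.

Lemma innerDl z x y : inner (x + y) z = inner x z + inner y z.
Proof. by rewrite innerC innerDr !(innerC z). Qed.

Lemma innerZr z a x : inner z (a *: x) = a * inner z x.
Proof. by rewrite linearZ. Qed.

Lemma innerZl z a x : inner (a *: x) z = a * inner x z.
Proof. by rewrite innerC innerZr innerC. Qed.

Lemma innerNr z x : inner z (- x) = - inner z x.
Proof. by rewrite raddfN. Qed.

Lemma innerNl z x : inner (- x) z = - inner x z.
Proof. by rewrite innerC innerNr innerC. Qed.

Lemma innerBr z x y : inner z (x - y) = inner z x - inner z y.
Proof. by rewrite innerDr innerNr. Qed.

Lemma innerBl z x y : inner (x - y) z = inner x z - inner y z.
Proof. by rewrite innerDl innerNl. Qed.

Lemma inner0r z : inner z 0 = 0.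
Proof. by rewrite raddf0. Qed.

Lemma inner0l z : inner 0 z = 0.
Proof. by rewrite innerC inner0r. Qed.

Lemma inner_sumr I (r : seq I) (P : pred I) (f : I -> X) z :
  inner z (\sum_(i <- r | P i) f i) = \sum_(i <- r | P i) inner z (f i).
Proof. exact: raddf_sum. Qed.

Lemma inner_ge0 x : 0 <= inner x x.
Proof.
have [->|x0] := eqVneq x 0; first by rewrite inner0r.
by apply/ltW/neq0_dnorm_gt0.
Qed.

Lemma inner_eq0 x : inner x x = 0 -> x = 0.
Proof.
move=> xx; apply/eqP; case: (eqVneq x 0) => // x0.
by have := neq0_dnorm_gt0 (s := inner) x x0; rewrite xx ltxx.
Qed.

Lemma inner_sqr x : inner x x = `|x| ^+ 2.
Proof. by rewrite normr_inner sqr_sqrtr// inner_ge0. Qed.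

Lemma inner_ext x y : (forall d, inner x d = inner y d) -> x = y.
Proof.
by move=> xy; apply/eqP; rewrite -subr_eq0; apply/eqP/inner_eq0;
  rewrite innerBl xy subrr.
Qed.

Lemma inner_cauchy x y : `|inner x y| <= `|x| * `|y|.
Proof.
have [->|y0] := eqVneq y 0; first by rewrite inner0r !normr0 mulr0.
have yy : 0 < `|y| ^+ 2 by rewrite exprn_gt0// normr_gt0.
rewrite -ler_sqr ?nnegrE ?mulr_ge0// real_normK ?num_real// exprMn.
have := inner_ge0 (`|y| ^+ 2 *: x - inner x y *: y).
rewrite innerBl !innerBr !innerZl !innerZr (innerC y x) !inner_sqr.
set a := `|x|; set c := `|y| in yy *; set q := inner x y => h.
have : 0 <= c ^+ 2 * (a ^+ 2 * c ^+ 2 - q ^+ 2).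
  by apply: le_trans h _; rewrite le_eqVlt; apply/orP; left; apply/eqP; ring.
by rewrite pmulr_rge0// subr_ge0.
Qed.

Lemma inner_le x y : inner x y <= `|x| * `|y|.
Proof. exact: le_trans (ler_norm _) (inner_cauchy x y). Qed.

Lemma cvg_inner T (F : set_system T) (FF : Filter F) (f h : T -> X) x y :
  f @ F --> x -> h @ F --> y -> (fun k => inner (f k) (h k)) @ F --> inner x y.
Proof.
move=> fx hy; apply/cvgrPdist_lt => e e0.
have M0 : 0 < `|y| + `|x| + 1 by rewrite ltr_wpDl ?addr_ge0.
pose r := Num.min 1 (e / (`|y| + `|x| + 1) / 2).
have r0 : 0 < r by rewrite lt_min ltr01 !divr_gt0.
have Hf : \forall k \near F, `|x - f k| < r by move/cvgrPdist_lt: fx; apply.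
have Hh : \forall k \near F, `|y - h k| < r by move/cvgrPdist_lt: hy; apply.
near=> k.
have hf : `|x - f k| < r by near: k.
have hh : `|y - h k| < r by near: k.
have hk : `|h k| <= `|y| + 1.
  have -> : h k = y - (y - h k) by rewrite opprB addrC subrK.
  apply: le_trans (ler_normB _ _) _; rewrite lerD2l.
  by apply: (le_trans (ltW hh)); rewrite /r ge_min lexx.
have -> : inner x y - inner (f k) (h k) = inner x (y - h k) + inner (x - f k) (h k).
  by rewrite innerBr innerBl; ring.
apply: le_lt_trans (ler_normD _ _) _.
apply: (@le_lt_trans _ _ (r * (`|y| + `|x| + 1))).
  have h1 : `|inner x (y - h k)| <= `|x| * r.
    by apply: le_trans (inner_cauchy _ _) _; rewrite ler_wpM2l// ltW.
  have h2 : `|inner (x - f k) (h k)| <= r * (`|y| + 1).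
    by apply: le_trans (inner_cauchy _ _) _; rewrite ler_pM// ltW.
  by apply: le_trans (lerD h1 h2) _; rewrite le_eqVlt; apply/orP; left; apply/eqP; ring.
apply: (@le_lt_trans _ _ (e / (`|y| + `|x| + 1) / 2 * (`|y| + `|x| + 1))).
  by rewrite ler_wpM2r// ?(ltW M0)// /r ge_min lexx orbT.
rewrite mulrAC divfK ?gt_eqF//; lra.
Unshelve. all: by end_near. Qed.

Definition gram_row (v : X) : 'rV[R]_(dim X) :=
  \row_j inner v (r2v (delta_mx 0 j)).

Lemma gram_row_linear : linear gram_row.
Proof.
by move=> a u v; apply/rowP => j; rewrite !mxE innerDl innerZl.
Qed.

HB.instance Definition _ := GRing.isLinear.Build R X 'rV[R]_(dim X) _ gram_row
  gram_row_linear.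

Lemma r2v_sum (v : X) : v = \sum_i v2r v 0 i *: r2v (delta_mx 0 i).
Proof.
rewrite -{1}(v2rK v) {1}(row_sum_delta (v2r v)) linear_sum.
by apply: eq_bigr => i _; rewrite linearZ.
Qed.

(** The Gram map sends v to its pairings with a basis. It is injective because
    the form is definite, hence onto by equality of dimensions: this provides
    the representing vector that riesz selects. *)
Lemma rieszP (l : X -> R) : linear l -> forall x, inner (riesz l) x = l x.
Proof.
move=> ll; pose L := HB.pack_for {linear X -> R} l
  (GRing.isLinear.Build R X R _ l ll).
suff [v vP] : exists v, forall x, l x = inner v x.
  by rewrite /riesz; case: xgetP => [w _ /= wP x|/(_ v)//]; rewrite wP.
pose f := lin1_mx (gram_row \o r2v).
have fE (u : 'rV[R]_(dim X)) : u *m f = gram_row (r2v u) by rewrite mul_rV_lin1.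
have f_free : row_free f.
  rewrite -kermx_eq0 -submx0; apply/rV_subP => u /sub_kermxP; rewrite fE => u0.
  suff /eqP : r2v u = 0 by rewrite -[X in _ == X](linear0 r2v) (inj_eq (can_inj r2vK)) => /eqP ->; rewrite sub0mx.
  apply: inner_eq0; rewrite [X in inner _ X]r2v_sum inner_sumr big1// => j _.
  rewrite innerZr; move/rowP/(_ j): u0; rewrite !mxE => ->.
  by rewrite mulr0.
pose c := \row_j l (r2v (delta_mx 0 j)).
exists (r2v (c *m invmx f)) => x.
have cE : gram_row (r2v (c *m invmx f)) = c.
  by rewrite -fE mulmxKV// -row_free_unit.
rewrite [in LHS](r2v_sum x) [in RHS](r2v_sum x) -[l _]/(L _) inner_sumr linear_sum.
apply: eq_bigr => j _; rewrite innerZr linearZ /=; congr (_ * _).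
by move/rowP/(_ j): cE; rewrite !mxE => ->.
Qed.

End Euclid.

(** * Compactness along ultrafilters *)

Section Ultra.
Context {R : realType} {T : Type}.
Variables (U : set_system T) (UU : UltraFilter U).

(** Ultrafilters replace the extraction of subsequences: once one nonprincipal
    ultrafilter on the indices is fixed, all bounded sequences of a
    finite-dimensional argument converge along it simultaneously. *)
Lemma compact_ultra_cvg (V : topologicalType) (A : set V) (f : T -> V) :
  compact A -> (\forall k \near U, A (f k)) -> exists2 l, A l & f @ U --> l.
Proof.
move=> Ac Af; have [l [Al cl]] := Ac (f @ U) _ Af.
exists l => // B lB; have [//|nB] := in_ultra_setVsetC (f @^-1` B) UU.
by have [x []] := cl (~` B) B nB lB.
Qed.

Lemma bounded_ultra_cvg (f : T -> R) (M : R) :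
  (\forall k \near U, `|f k| <= M) -> exists l : R, f @ U --> l.
Proof.
move=> fM; have [|l _ fl] := compact_ultra_cvg (f := f) (@segment_compact R (- M) M).
  by near=> k; rewrite /= in_itv /= -ler_norml; near: k.
by exists l.
Unshelve. all: by end_near. Qed.

(** Bounded coordinates converge one by one along an ultrafilter, so the vector
    they determine converges. *)
Lemma coord_ultra_cvg (V : normedModType R) (I : finType) (e : I -> V)
    (c : I -> V -> R) (f : T -> V) :
  (forall v, v = \sum_i c i v *: e i) ->
  (forall i, exists M, \forall k \near U, `|c i (f k)| <= M) ->
  exists l : V, f @ U --> l.
Proof.
move=> ce cb.
have /choice[l lP] i : exists l : R, (c i \o f) @ U --> l.
  by have [M /bounded_ultra_cvg] := cb i.
exists (\sum_i l i *: e i).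
rewrite (_ : f = fun k => \sum_i c i (f k) *: e i); last by apply/funext.
apply: cvg_big => [|i _]; first exact: add_continuous.
by apply: cvgZr_tmp; exact: lP.
Qed.

End Ultra.

Lemma cvg_near_unique (R : realType) (V : normedModType R) I (F : set_system I)
    (FF : ProperFilter F) (f h : I -> V) (x y : V) :
  (\forall k \near F, f k = h k) -> f @ F --> x -> h @ F --> y -> x = y.
Proof.
move=> fh fx hy; apply: (@norm_cvg_unique R V (f @ F) _ x y fx).
by apply: cvg_trans hy; apply: near_eq_cvg; apply: filterS fh => k ->.
Qed.

Lemma cvg_le (R : realType) I (F : set_system I) (FF : ProperFilter F)
    (f h : I -> R) (x y : R) :
  f @ F --> x -> h @ F --> y -> (\forall k \near F, f k <= h k) -> x <= y.
Proof.
move=> fx hy fh; rewrite -subr_ge0.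
apply: (@closed_cvg _ _ F _ (h \- f) [set z : R | 0 <= z]).
- exact: closed_ge.
- by apply: filterS fh => k; rewrite /= subr_ge0.
- exact: cvgB.
Qed.

Lemma le_mx_norm (R : realType) m n (M : 'M[R]_(m, n)) i j : `|M i j| <= `|M|.
Proof.
rewrite [leRHS]/Num.norm /= mx_normrE; apply: (le_bigmax _ _ (i, j)).
Qed.

Lemma mx_ultra_cvg (R : realType) T (U : set_system T) (UU : UltraFilter U)
    m n (f : T -> 'M[R]_(m, n)) (C : R) :
  (forall i j, \forall k \near U, `|f k i j| <= C) -> exists l : 'M[R]_(m, n), f @ U --> l.
Proof.
move=> fC; apply: (@coord_ultra_cvg _ _ _ _ _ _ (fun ij => delta_mx ij.1 ij.2)
  (fun ij M => M ij.1 ij.2)) => [M|ij]; last by exists C; exact: fC.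
by rewrite {1}(matrix_sum_delta M) pair_bigA.
Qed.

(** Closedness in the form in which it is checked below: by passing to the limit
    in the equations and inequalities that define the set. *)
Definition limit_closed (V : topologicalType) (A : set V) :=
  forall F : set_system V, ProperFilter F -> F A -> forall l, F --> l -> A l.

Lemma mx_compact (R : realType) m n (A : set 'M[R]_(m, n)) (C : R) :
  limit_closed A -> (forall M, A M -> forall i j, `|M i j| <= C) -> compact A.
Proof.
move=> Acl AC; rewrite compact_ultra => U UU UA.
have [|l Ul] := @mx_ultra_cvg _ _ U UU _ _ id C.
  by move=> i j; apply: filterS UA => M /AC; apply.
by exists l; split=> //; apply: (Acl U).
Qed.

Section EuclidCompact.
Context {R : realType} {X : euclideanType R}.

Lemma euclid_ultra_cvg T (U : set_system T) (UU : UltraFilter U)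
    (f : T -> X) (C : R) :
  (\forall k \near U, `|f k| <= C) -> exists l : X, f @ U --> l.
Proof.
move=> fC; apply: (@coord_ultra_cvg _ _ _ _ _ _ (fun j => r2v (delta_mx 0 j))
  (fun j x => v2r x 0 j)) => [x|j]; first exact: r2v_sum.
have lj : linear (fun x : X => v2r x 0 j) by move=> a x y; rewrite linearP !mxE.
exists (`|riesz (fun x : X => v2r x 0 j)| * C).
apply: filterS fC => k fk; rewrite -(rieszP lj).
by apply: le_trans (inner_cauchy _ _) _; rewrite ler_wpM2l.
Qed.

Lemma euclid_compact (A : set X) (C : R) :
  limit_closed A -> (forall x, A x -> `|x| <= C) -> compact A.
Proof.
move=> Acl AC; rewrite compact_ultra => U UU UA.
have [|l Ul] := @euclid_ultra_cvg _ U UU id C; first exact: filterS UA.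
by exists l; split=> //; apply: (Acl U).
Qed.

End EuclidCompact.

(** * First-order calculus *)

Section Calc.
Context {R : realType} {X : euclideanType R}.
Implicit Types (x u v w d : X).

Lemma is_derive_line (W : normedModType R) (f : X -> W) x d (t : R) :
  differentiable f (x + t *: d) ->
  is_derive t 1 (fun s : R => f (x + s *: d)) ('d f (x + t *: d) d).
Proof.
move=> df.
have dl : is_diff t (fun s : R => x + s *: d) (fun s => s *: d).
  have : is_diff t (cst x + (fun s : R => s *: d)) (0 + (fun s => s *: d)).
    exact: is_diffD.
  by rewrite add0r.
have dfl : is_diff (x + t *: d) f ('d f (x + t *: d)) by split.
have := @is_diff_comp _ _ _ _ _ _ _ _ _ dl dfl => -[dc cE].
split; first exact: diff_derivable.
by rewrite deriveE// cE /= scale1r.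
Qed.

Lemma mvt_line (f : X -> R) x d :
  (forall t : R, 0 <= t <= 1 -> differentiable f (x + t *: d)) ->
  exists2 c : R, 0 < c < 1 & f (x + d) - f x = 'd f (x + c *: d) d.
Proof.
move=> df.
have [||c] := @MVT R (fun s : R => f (x + s *: d)) (fun t => 'd f (x + t *: d) d) 0 1
  ltr01.
- move=> t; rewrite in_itv /= => /andP[t0 t1].
  by apply: is_derive_line; apply: df; rewrite !ltW.
- apply: continuous_in_subspaceT => t; rewrite inE /= in_itv /= => t01.
  apply: differentiable_continuous; apply/derivable1_diffP.
  by have [] := is_derive_line (df t t01).
rewrite in_itv /= => c01; rewrite scale1r scale0r addr0 subr0 mulr1 => fE.
by exists c.
Qed.

Lemma diff_quotient_cvg (W : normedModType R) (f : X -> W) x d :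
  differentiable f x ->
  (fun t : R => t^-1 *: (f (x + t *: d) - f x)) @ 0^'+ --> 'd f x d.
Proof.
move=> df.
have : (fun h : R => h^-1 *: (f (h *: d + x) - f x)) @ 0^' --> 'd f x d.
  by rewrite -deriveE//; exact: diff_derivable.
move=> /cvg_dnbhs_at_right; apply: cvg_trans.
by apply: near_eq_cvg; apply: nearW => h; rewrite [x + _]addrC.
Qed.

Lemma diff_ge (f : X -> R) x d (r a : R) :
  differentiable f x -> 0 < r ->
  (forall t : R, 0 < t < r -> f x + t * a <= f (x + t *: d)) -> a <= 'd f x d.
Proof.
move=> df r0 fr.
apply: (@cvg_le R R 0^'+ _ (fun=> a) (fun t => t^-1 * (f (x + t *: d) - f x))).
- exact: cvg_cst.
- exact: diff_quotient_cvg.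
near=> t.
have t0 : 0 < t by near: t; exact: nbhs_right_gt.
have tr : t < r by near: t; exact: nbhs_right_lt.
by rewrite ler_pdivlMl// lerBrDl fr// t0.
Unshelve. all: by end_near. Qed.

Lemma linear_coord (l : {linear X -> R}) x :
  l x = \sum_j v2r x 0 j * l (r2v (delta_mx 0 j)).
Proof. by rewrite {1}(r2v_sum x) linear_sum; apply: eq_bigr => j _; rewrite linearZ. Qed.

(** Dual basis of the coordinate basis for the inner product. *)
Definition dual_vec j : X := riesz (fun x : X => v2r x 0 j).

Lemma dual_vecP j x : inner (dual_vec j) x = v2r x 0 j.
Proof. by rewrite rieszP// => a u v; rewrite linearP !mxE. Qed.

Lemma cvg_coord T (F : set_system T) (FF : Filter F) (f : T -> X) x j :
  f @ F --> x -> (fun k => v2r (f k) 0 j) @ F --> v2r x 0 j.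
Proof.
move=> fx; rewrite -dual_vecP.
rewrite (_ : (fun k => _) = fun k => inner (dual_vec j) (f k)).
  by apply: cvg_inner => //; exact: cvg_cst.
by apply/funext => k; rewrite dual_vecP.
Qed.

(** Continuity of the differential in each fixed direction suffices for joint
    continuity, since a direction is a combination of finitely many basis
    vectors with continuous coefficients. *)
Lemma cvg_diff T (F : set_system T) (FF : Filter F) (f : X -> R) (xi wk : T -> X) x w :
  (forall u, {for x, continuous (fun y => 'd f y u)}) ->
  xi @ F --> x -> wk @ F --> w ->
  (fun k => 'd f (xi k) (wk k)) @ F --> 'd f x w.
Proof.
move=> fc xix wkw; rewrite linear_coord.
rewrite (_ : (fun k => _) = fun k => \sum_j v2r (wk k) 0 j *
    'd f (xi k) (r2v (delta_mx 0 j))); last first.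
  by apply/funext => k; rewrite linear_coord.
apply: cvg_big => [|j _]; first exact: add_continuous.
apply: cvgM; first exact: cvg_coord.
exact: (@cvg_comp _ _ _ xi (fun y => 'd f y (r2v (delta_mx 0 j))) _ _ _ xix (fc _)).
Qed.

Lemma segment_dist x0 x d (c r : R) : 0 <= c <= 1 ->
  `|x0 - x| < r -> `|x0 - (x + d)| < r -> `|x0 - (x + c *: d)| < r.
Proof.
move=> /andP[c0 c1] h1 h2.
have -> : x0 - (x + c *: d) = (1 - c) *: (x0 - x) + c *: (x0 - (x + d)).
  rewrite !opprD !addrA; move: (x0 - x) => a.
  by rewrite (scalerBr c) scalerBl scale1r addrA subrK.
apply: le_lt_trans (ler_normD _ _) _; rewrite !normrZ.
rewrite (ger0_norm c0) ger0_norm ?subr_ge0//.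
have [c_0|c_0] := eqVneq c 0; first by rewrite c_0 subr0 mul0r mul1r addr0.
have cp : 0 < c by rewrite lt_neqAle eq_sym c_0.
have : c * `|x0 - (x + d)| < c * r by rewrite ltr_pM2l.
have : (1 - c) * `|x0 - x| <= (1 - c) * r by rewrite ler_wpM2l ?subr_ge0// ltW.
lra.
Qed.

(** The mean value theorem puts the difference quotient between two moving
    points at an intermediate point, which converges to the same limit. *)
Lemma strict_diff T (F : set_system T) (FF : Filter F) (f : X -> R)
    (x1 x2 : T -> X) (t : T -> R) x w :
  (\forall y \near x, differentiable f y) ->
  (forall u, {for x, continuous (fun y => 'd f y u)}) ->
  x1 @ F --> x -> x2 @ F --> x -> (forall k, t k != 0) ->
  (fun k => (t k)^-1 *: (x1 k - x2 k)) @ F --> w ->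
  (fun k => (t k)^-1 * (f (x1 k) - f (x2 k))) @ F --> 'd f x w.
Proof.
move=> /nbhs_ballP[r /= r0 df] fc x1x x2x t0 wt.
have xi_ex k : exists c : R, 0 <= c <= 1 /\ (ball x r (x1 k) -> ball x r (x2 k) ->
    f (x1 k) - f (x2 k) = 'd f (x2 k + c *: (x1 k - x2 k)) (x1 k - x2 k)).
  have [[b1 b2]|nb] := pselect (ball x r (x1 k) /\ ball x r (x2 k)); last first.
    exists 0; rewrite lexx ler01; split=> // b1 b2; by case: nb.
  have [|c /andP[c0 c1]] := @mvt_line f (x2 k) (x1 k - x2 k).
    move=> s s01; apply: df; move: b1 b2; rewrite -ball_normE /= => b1 b2.
    by apply: segment_dist => //; rewrite subrKC.
  by rewrite subrKC => fE; exists c; rewrite !ltW.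
have [c cP] := choice xi_ex.
have B1 : \forall k \near F, ball x r (x1 k) by apply: x1x; exact: nbhsx_ballx.
have B2 : \forall k \near F, ball x r (x2 k) by apply: x2x; exact: nbhsx_ballx.
have xix : (fun k => x2 k + c k *: (x1 k - x2 k)) @ F --> x.
  apply/cvgrPdist_lt => e e0.
  move/cvgrPdist_lt : (x1x) => /(_ _ e0) H1; move/cvgrPdist_lt : (x2x) => /(_ _ e0) H2.
  near=> k; apply: segment_dist; first by have [] := cP k.
    by near: k.
  by rewrite subrKC; near: k.
apply: cvg_trans (cvg_diff FF fc xix wt).
apply: near_eq_cvg; near=> k.
have [_ ->] := cP k; first by rewrite linearZ.
  by near: k.
by near: k.
Unshelve. all: by end_near. Qed.

Lemma diff_linear (f : X -> R) x : linear ('d f x : X -> R).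
Proof. by move=> a u v; rewrite linearP. Qed.

Lemma gradientP (f : X -> R) x d : inner (gradient f x) d = 'd f x d.
Proof. exact: (rieszP (diff_linear f x)). Qed.

(** Expanding on the dual basis reduces the differentiability of the gradient
    to that of the directional derivatives. *)
Lemma gradient_sum (f : X -> R) :
  gradient f = fun x => \sum_j 'd f x (r2v (delta_mx 0 j)) *: dual_vec j.
Proof.
apply/funext => x; apply: inner_ext => d; rewrite gradientP linear_coord innerC.
rewrite inner_sumr; apply: eq_bigr => j _.
by rewrite innerZr innerC dual_vecP mulrC.
Qed.

Lemma gradient_diff (f : X -> R) x :
  (forall u, differentiable (fun y => 'd f y u) x) ->
  differentiable (gradient f) x /\
  forall w u, inner (hessian f x w) u = 'd (fun y => 'd f y u) x w.
Proof.
move=> df.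
have D j : differentiable (fun y => 'd f y (r2v (delta_mx 0 j)) *: dual_vec j) x.
  exact: differentiableZl.
have Dg : differentiable (gradient f) x.
  rewrite gradient_sum (_ : (fun y => _) = \sum_j (fun y => 'd f y (r2v (delta_mx 0 j)) *: dual_vec j)).
    exact: differentiable_sum.
  by apply/funext => y; rewrite fct_sumE.
split=> // w u.
pose l : X -> R := inner u.
have ll : linear l by move=> a v1 v2; rewrite /l innerDr innerZr.
pose L := HB.pack_for {linear X -> R} l (GRing.isLinear.Build R X R _ l ll).
have E : (fun y => 'd f y u) = L \o gradient f.
  by apply/funext => y /=; rewrite /l innerC gradientP.
have Lc : continuous L.
  by move=> v; apply: cvg_inner; [exact: cvg_cst|exact: cvg_id].
rewrite E diff_comp//; last exact: linear_differentiable.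
by rewrite diff_lin//= /l innerC.
Qed.

End Calc.

(** * Second-order calculus *)

Section C2.
Context {R : realType} {X : euclideanType R}.
Variables (O : set X) (f : X -> R).
Hypotheses (O_open : open O) (fC2 : C2_on O f).
Implicit Types (x u v w d : X).

Let f1 x : O x -> differentiable f x. Proof. by case: fC2 => + _ _; apply. Qed.
Let f2 u x : O x -> differentiable (fun y => 'd f y u) x.
Proof. by case: fC2 => _ + _; apply. Qed.
Let f3 u w x : O x -> {for x, continuous (fun y => 'd (fun z => 'd f z u) y w)}.
Proof. by case: fC2 => _ _ +; apply. Qed.

Lemma hessianP x w u : O x ->
  inner (hessian f x w) u = 'd (fun y => 'd f y u) x w.
Proof. by move=> Ox; have [|_ ->] := @gradient_diff _ _ f x => // u'; exact: f2. Qed.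

Lemma gradient_cont x : O x -> {for x, continuous (gradient f)}.
Proof.
move=> Ox; apply: differentiable_continuous.
by have [|] := @gradient_diff _ _ f x => // u'; exact: f2.
Qed.

(** Two applications of the mean value theorem to the second difference on a
    small parallelogram. *)
Lemma square_diff x u w : O x -> forall e : R, 0 < e ->
  exists2 r, 0 < r & forall s : R, 0 < s < r ->
  `|'d (fun y => 'd f y w) x u - (s ^+ 2)^-1 *
     (f (x + s *: u + s *: w) - f (x + s *: u) - f (x + s *: w) + f x)| < e.
Proof.
move=> Ox e e0.
have : \forall y \near x, O y /\
    `|'d (fun y => 'd f y w) x u - 'd (fun y => 'd f y w) y u| < e.
  near=> y; split; near: y; first exact: open_nbhs_nbhs.
  by move/cvgrPdist_lt: (@f3 w u x Ox); apply.
move=> /nbhs_ballP[r0 /= r00 Hr].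
have M0 : 0 < `|u| + `|w| + 1 by rewrite ltr_wpDl ?addr_ge0.
exists (r0 / (`|u| + `|w| + 1)); first by rewrite divr_gt0.
move=> s /andP[s0]; rewrite ltr_pdivlMr// => sr.
have inb (a b : R) : 0 <= a <= s -> 0 <= b <= s -> ball x r0 (x + a *: u + b *: w).
  move=> /andP[a0 als] /andP[b0 bs]; rewrite -ball_normE /= -addrA opprD addNKr.
  rewrite normrN; apply: le_lt_trans (ler_normD _ _) _; rewrite !normrZ.
  apply: le_lt_trans sr; rewrite !ger0_norm// !mulrDr mulr1.
  have : a * `|u| <= s * `|u| by rewrite ler_wpM2r.
  have : b * `|w| <= s * `|w| by rewrite ler_wpM2r.
  by have := s0; lra.
have s0' := ltW s0.
pose h y : R := f (y + s *: u) - f y.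
have dshift y : O (y + s *: u) -> is_diff y (fun y => f (y + s *: u)) ('d f (y + s *: u)).
  move=> Oy.
  have dl : is_diff y (fun z : X => z + s *: u) id.
    have : is_diff y (id + cst (s *: u)) (id + 0) by exact: is_diffD.
    by rewrite addr0.
  have dfl : is_diff (y + s *: u) f ('d f (y + s *: u)) by split; [exact: f1|].
  exact: (@is_diff_comp _ _ _ _ _ _ _ _ _ dl dfl).
have dh y : O y -> O (y + s *: u) -> is_diff y h (fun v => 'd f (y + s *: u) v - 'd f y v).
  move=> Oy Oy'; have D1 := dshift y Oy'.
  have D2 : is_diff y f ('d f y) by split; [exact: f1|].
  exact: is_diffB.
have [t t01|th /andP[th0 th1] hE] := @mvt_line _ _ h x (s *: w).
  have ts : 0 <= t * s <= s.
    by case/andP: t01 => t0 t1; rewrite mulr_ge0//= ler_piMl.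
  rewrite scalerA; have [] // := dh (x + (t * s) *: w).
    have [] // := Hr (x + (t * s) *: w).
    by have := inb 0 (t * s); rewrite scale0r addr0; apply => //; rewrite lexx.
  rewrite addrAC.
  have [] // := Hr (x + s *: u + (t * s) *: w).
  by apply: inb => //; rewrite s0' lexx.
set z := x + th *: (s *: w) in hE.
have ts : 0 <= th * s <= s by rewrite mulr_ge0//= ?ler_piMl// ltW.
have Oz : O z.
  have [] // := Hr z; rewrite /z scalerA.
  by have := inb 0 (th * s); rewrite scale0r addr0; apply => //; rewrite lexx.
have Oz' : O (z + s *: u).
  have [] // := Hr (z + s *: u); rewrite /z scalerA addrAC.
  by apply: inb => //; rewrite s0' lexx.
have [_ dhE] := dh z Oz Oz'; rewrite dhE in hE.
have [t t01|th' /andP[th'0 th'1]] := @mvt_line _ _ (fun y => 'd f y w) z (s *: u).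
  apply: f2.
  have ts' : 0 <= t * s <= s.
    by case/andP: t01 => t0 t1; rewrite mulr_ge0//= ler_piMl.
  rewrite /z !scalerA addrAC.
  by have [] // := Hr (x + (t * s) *: u + (th * s) *: w); apply: inb.
move=> gE.
have -> : (s ^+ 2)^-1 * (f (x + s *: u + s *: w) - f (x + s *: u) - f (x + s *: w) + f x)
  = 'd (fun y => 'd f y w) (z + th' *: (s *: u)) u.
  have -> : f (x + s *: u + s *: w) - f (x + s *: u) - f (x + s *: w) + f x =
     h (x + s *: w) - h x.
    by rewrite /h [x + s *: w + s *: u]addrAC; ring.
  have hE' : h (x + s *: w) - h x = s * ('d f (z + s *: u) w - 'd f z w).
    by rewrite hE !linearZ /= -scalerDr.
  rewrite hE' gE linearZ /= /GRing.scale /=; field.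
  by rewrite gt_eqF.
have [] // := Hr (z + th' *: (s *: u)).
rewrite /z !scalerA addrAC; apply: inb => //.
by rewrite mulr_ge0//= ?ler_piMl// ltW.
Unshelve. all: by end_near. Qed.

(** Schwarz: the second difference of square_diff is symmetric in the two
    directions. *)
Lemma second_diff_sym x u w : O x ->
  'd (fun y => 'd f y w) x u = 'd (fun y => 'd f y u) x w.
Proof.
move=> Ox; apply/eqP; rewrite -subr_eq0 -normr_le0; apply/ler_addgt0Pr => e e0.
have e2 : 0 < e / 2 by rewrite divr_gt0.
have [r1 r10 H1] := square_diff u w Ox e2.
have [r2 r20 H2] := square_diff w u Ox e2.
pose s := Num.min r1 r2 / 2.
have m0 : 0 < Num.min r1 r2 by rewrite lt_min r10.
have s0 : 0 < s by rewrite divr_gt0.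
have sm : s < Num.min r1 r2 by rewrite /s; lra.
have {H1} := H1 s; rewrite s0 (lt_le_trans sm) ?ge_min ?lexx// => /(_ isT) H1.
have {H2} := H2 s; rewrite s0 (lt_le_trans sm) ?ge_min ?lexx ?orbT// => /(_ isT).
rewrite [x + s *: w + s *: u]addrAC.
rewrite (_ : f (x + s *: u + s *: w) - f (x + s *: w) - f (x + s *: u) + f x =
  f (x + s *: u + s *: w) - f (x + s *: u) - f (x + s *: w) + f x); last by ring.
move: H1; set q := _ * _ => H1; rewrite distrC => H2.
have := ler_distD q ('d (fun y => 'd f y w) x u) ('d (fun y => 'd f y u) x w).
by rewrite add0r; lra.
Qed.

Lemma gradient_strict T (F : set_system T) (FF : Filter F)
    (x1 x2 : T -> X) (t : T -> R) x w : O x ->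
  x1 @ F --> x -> x2 @ F --> x -> (forall k, t k != 0) ->
  (fun k => (t k)^-1 *: (x1 k - x2 k)) @ F --> w ->
  (fun k => (t k)^-1 *: (gradient f (x1 k) - gradient f (x2 k))) @ F -->
    hessian f x w.
Proof.
move=> Ox x1x x2x t0 wt.
pose fj j y := 'd f y (r2v (delta_mx 0 j)).
have -> : hessian f x w = \sum_j 'd (fj j) x w *: dual_vec j.
  apply: inner_ext => u; rewrite [RHS]innerC inner_sumr hessianP// (second_diff_sym w u Ox).
  rewrite (linear_coord _ u); apply: eq_bigr => j _.
  by rewrite innerZr [inner u _]innerC dual_vecP mulrC (second_diff_sym _ w Ox).
rewrite (_ : (fun k => _) = fun k => \sum_j
    ((t k)^-1 * (fj j (x1 k) - fj j (x2 k))) *: dual_vec j); last first.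
  apply/funext => k; rewrite gradient_sum -sumrB scaler_sumr.
  by apply: eq_bigr => j _; rewrite -scalerBl scalerA.
apply: cvg_big => [|j _]; first exact: add_continuous.
apply: cvgZr_tmp; apply: strict_diff => //.
  by near=> y; apply: f2; near: y; exact: open_nbhs_nbhs.
by move=> u; exact: f3.
Unshelve. all: by end_near. Qed.

(** The null directions of a symmetric positive semidefinite form are its
    kernel; the symmetry is second_diff_sym. *)
Lemma psd_kernel x w : O x -> (forall u, 0 <= inner u (hessian f x u)) ->
  inner (hessian f x w) w = 0 -> hessian f x w = 0.
Proof.
move=> Ox psd ww; apply: inner_eq0; set q := hessian f x w.
have sym u v : inner (hessian f x u) v = inner (hessian f x v) u.
  by rewrite !hessianP// second_diff_sym.
have qs (s : R) : 0 <= s * (2 * inner q q) + s ^+ 2 * inner q (hessian f x q).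
  have := psd (w + s *: q); rewrite {1}/hessian linearD linearZ /= -!/(hessian _ _ _).
  rewrite !innerDl !innerDr !innerZl !innerZr.
  rewrite (innerC w) ww (innerC w) (sym q w) -/q innerC => h.
  by apply: le_trans h _; rewrite le_eqVlt; apply/orP; left; apply/eqP; ring.
set a := inner q q in qs *; set c := inner q _ in qs.
have a0 : 0 <= a by exact: inner_ge0.
have c0 : 0 <= c by exact: psd.
apply/eqP; rewrite eq_le a0 andbT.
(* The minimizing s is - a / c; the denominator c + 1 cannot vanish. *)
have := qs (- (a / (c + 1))).
have c1 : 0 < c + 1 by lra.
rewrite (_ : _ + _ = - (a ^+ 2 * (c + 2) / (c + 1) ^+ 2)); last first.
  by field; rewrite gt_eqF.
rewrite oppr_ge0 pmulr_lle0 ?invr_gt0 ?exprn_gt0// pmulr_lle0; last by lra.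
by rewrite exprn_even_le0//= => /eqP ->.
Qed.

Section Monotone.
Variables (xs : X) (r : R).
Hypothesis (rO : ball xs r `<=` O).
Hypothesis psd : forall x, ball xs r x -> forall w, 0 <= inner w (hessian f x w).

Lemma gradient_monotone x y : ball xs r x -> ball xs r y ->
  0 <= inner (gradient f x - gradient f y) (x - y).
Proof.
move=> bx by_.
have seg (c : R) : 0 <= c <= 1 -> ball xs r (y + c *: (x - y)).
  move: bx by_; rewrite -ball_normE /= => bx by_ c01.
  by apply: segment_dist => //; rewrite subrKC.
have [t t01|c c01] := @mvt_line _ _ (fun z => 'd f z (x - y)) y (x - y).
  by apply: f2; apply: rO; exact: seg.
rewrite subrKC innerBl !gradientP => ->.
have cb : ball xs r (y + c *: (x - y)) by apply: seg; case/andP: c01 => ? ?; rewrite !ltW.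
by rewrite -hessianP; [rewrite innerC; exact: psd|exact: rO].
Qed.

Lemma gradient_convex x y : ball xs r x -> ball xs r y ->
  f y + inner (gradient f y) (x - y) <= f x.
Proof.
move=> bx by_.
have seg (c : R) : 0 <= c <= 1 -> ball xs r (y + c *: (x - y)).
  move: bx by_; rewrite -ball_normE /= => bx by_ c01.
  by apply: segment_dist => //; rewrite subrKC.
have [t t01|c c01] := @mvt_line _ _ f y (x - y).
  by apply: f1; apply: rO; exact: seg.
rewrite subrKC => fE.
have [c0 c1] : 0 < c /\ c < 1 by case/andP: c01.
have c01' : 0 <= c <= 1 by rewrite !ltW.
have := gradient_monotone (seg c c01') by_.
rewrite [X in inner _ X]addrAC subrr add0r innerZr pmulr_rge0// innerBl (gradientP f (_ + _)) -fE.
by lra.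
Qed.
End Monotone.
End C2.

Section SmoothMap.
Context {R : realType} {X : euclideanType R} {W : normedModType R}.
Variables (g : X -> W) (g_C2 : C2_on [set: X] g).

Lemma C2_cvg T (F : set_system T) (FF : Filter F) (h : T -> X) x :
  h @ F --> x -> (fun k => g (h k)) @ F --> g x.
Proof.
move=> hx; have gc : {for x, continuous g}.
  by apply: differentiable_continuous; case: g_C2 => + _ _; apply.
exact: (@cvg_comp _ _ _ h g _ _ _ hx gc).
Qed.

Lemma C2_diff_cvg T (F : set_system T) (FF : Filter F) (h : T -> X) x d :
  h @ F --> x -> (fun k => 'd g (h k) d) @ F --> 'd g x d.
Proof.
move=> hx; have gc : {for x, continuous (fun y => 'd g y d)}.
  by apply: differentiable_continuous; case: g_C2 => _ + _; apply.
exact: (@cvg_comp _ _ _ h (fun y => 'd g y d) _ _ _ hx gc).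
Qed.

End SmoothMap.

(** * The trace inner product and positive semidefinite matrices *)

Section MxInner.
Context {R : realType}.

Lemma symmetricmxP n (M : 'M[R]_n) : (M \is symmetricmx) = (M == M^T).
Proof. by rewrite qualifE /= expr0 scale1r map_mx_id. Qed.

Lemma mxinnerE p q (A B : 'M[R]_(p, q)) :
  mxinner A B = \sum_i \sum_j A i j * B i j.
Proof.
rewrite /mxinner /mxtrace exchange_big; apply: eq_bigr => j _.
by rewrite !mxE; apply: eq_bigr => i _; rewrite mxE.
Qed.

Lemma mxinnerC p q (A B : 'M[R]_(p, q)) : mxinner A B = mxinner B A.
Proof.
by rewrite !mxinnerE; apply: eq_bigr => i _; apply: eq_bigr => j _; rewrite mulrC.
Qed.

Lemma mxinnerDr p q (A B C : 'M[R]_(p, q)) :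
  mxinner A (B + C) = mxinner A B + mxinner A C.
Proof. by rewrite /mxinner mulmxDr mxtraceD. Qed.

Lemma mxinnerZr p q (A B : 'M[R]_(p, q)) a : mxinner A (a *: B) = a * mxinner A B.
Proof. by rewrite /mxinner -scalemxAr mxtraceZ. Qed.

Lemma mxinnerNr p q (A B : 'M[R]_(p, q)) : mxinner A (- B) = - mxinner A B.
Proof. by rewrite -scaleN1r mxinnerZr mulN1r. Qed.

Lemma mxinnerBr p q (A B C : 'M[R]_(p, q)) :
  mxinner A (B - C) = mxinner A B - mxinner A C.
Proof. by rewrite mxinnerDr mxinnerNr. Qed.

Lemma mxinnerDl p q (A B C : 'M[R]_(p, q)) :
  mxinner (B + C) A = mxinner B A + mxinner C A.
Proof. by rewrite mxinnerC mxinnerDr !(mxinnerC A). Qed.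

Lemma mxinnerZl p q (A B : 'M[R]_(p, q)) a : mxinner (a *: B) A = a * mxinner B A.
Proof. by rewrite mxinnerC mxinnerZr mxinnerC. Qed.

Lemma mxinnerNl p q (A B : 'M[R]_(p, q)) : mxinner (- B) A = - mxinner B A.
Proof. by rewrite mxinnerC mxinnerNr mxinnerC. Qed.

Lemma mxinnerBl p q (A B C : 'M[R]_(p, q)) :
  mxinner (B - C) A = mxinner B A - mxinner C A.
Proof. by rewrite mxinnerDl mxinnerNl. Qed.

Lemma mxinner0r p q (A : 'M[R]_(p, q)) : mxinner A 0 = 0.
Proof. by rewrite -(scale0r 0) mxinnerZr mul0r. Qed.

Lemma sqr_le_mxinner p q (A : 'M[R]_(p, q)) i j : A i j ^+ 2 <= mxinner A A.
Proof.
rewrite mxinnerE (bigD1 i)//= (bigD1 j)//= -expr2 -addrA lerDl addr_ge0//.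
  by apply: sumr_ge0 => k _; rewrite -expr2 sqr_ge0.
by apply: sumr_ge0 => k _; apply: sumr_ge0 => l _; rewrite -expr2 sqr_ge0.
Qed.

Lemma mxinner_ge0 p q (A : 'M[R]_(p, q)) : 0 <= mxinner A A.
Proof.
by rewrite mxinnerE sumr_ge0// => k _; apply: sumr_ge0 => l _; rewrite -expr2 sqr_ge0.
Qed.

Lemma mxinner_eq0 p q (A : 'M[R]_(p, q)) : mxinner A A = 0 -> A = 0.
Proof.
move=> A0; apply/matrixP => i j; rewrite mxE; apply/eqP; rewrite -sqrf_eq0.
by rewrite eq_le sqr_ge0 andbT -A0 sqr_le_mxinner.
Qed.

Lemma cvg_entry T (F : set_system T) (FF : Filter F) p q (f : T -> 'M[R]_(p, q)) (M : 'M[R]_(p, q)) i j :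
  f @ F --> M -> (fun k => f k i j) @ F --> M i j.
Proof.
move=> fM; exact: (@cvg_comp _ _ _ f (fun N : 'M[R]_(p, q) => N i j) _ _ _ fM
  (@coord_continuous _ _ _ i j M)).
Qed.

Lemma cvg_mx T (F : set_system T) (FF : Filter F) p q (f : T -> 'M[R]_(p, q)) (M : 'M[R]_(p, q)) :
  (forall i j, (fun k => f k i j) @ F --> M i j) -> f @ F --> M.
Proof.
move=> fM; rewrite (matrix_sum_delta M) pair_bigA.
rewrite (_ : f = fun k => \sum_p f k p.1 p.2 *: delta_mx p.1 p.2); last first.
  by apply/funext => k; rewrite {1}(matrix_sum_delta (f k)) pair_bigA.
apply: cvg_big => [|[i j] _]; first exact: add_continuous.
by apply: cvgZr_tmp; exact: fM.
Qed.

Lemma cvg_trmx T (F : set_system T) (FF : Filter F) p q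
    (f : T -> 'M[R]_(p, q)) (M : 'M[R]_(p, q)) :
  f @ F --> M -> (fun k => (f k)^T) @ F --> M^T.
Proof.
move=> fM; apply: cvg_mx => i j; rewrite mxE.
rewrite (_ : (fun k => _) = fun k => f k j i); first exact: cvg_entry.
by apply/funext => k; rewrite mxE.
Qed.

Lemma cvg_mxinner T (F : set_system T) (FF : Filter F) p q
    (f h : T -> 'M[R]_(p, q)) (M N : 'M[R]_(p, q)) :
  f @ F --> M -> h @ F --> N -> (fun k => mxinner (f k) (h k)) @ F --> mxinner M N.
Proof.
move=> fM hN; rewrite mxinnerE.
rewrite (_ : (fun k => _) = fun k => \sum_i \sum_j f k i j * h k i j); last first.
  by apply/funext => k; rewrite mxinnerE.
apply: cvg_big => [|i _]; first exact: add_continuous.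
apply: cvg_big => [|j _]; first exact: add_continuous.
by apply: cvgM; apply: cvg_entry.
Qed.

Lemma cvg_mulmx T (F : set_system T) (FF : Filter F) p q r
    (f : T -> 'M[R]_(p, q)) (h : T -> 'M[R]_(q, r)) (M : 'M[R]_(p, q)) (N : 'M[R]_(q, r)) :
  f @ F --> M -> h @ F --> N -> (fun k => f k *m h k) @ F --> M *m N.
Proof.
move=> fM hN; apply: cvg_mx => i j; rewrite mxE.
rewrite (_ : (fun k => _) = fun k => \sum_l f k i l * h k l j); last first.
  by apply/funext => k; rewrite mxE.
apply: cvg_big => [|l _]; first exact: add_continuous.
by apply: cvgM; apply: cvg_entry.
Qed.

End MxInner.
Arguments cvg_entry {R T F} FF {p q f M} i j _ [t] _.

Lemma symmetric_cvg (R : realType) n I (F : set_system I) (FF : ProperFilter F)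
    (f : I -> 'M[R]_n) (M : 'M[R]_n) :
  (\forall k \near F, f k \is symmetricmx) -> f @ F --> M -> M \is symmetricmx.
Proof.
move=> fs fM; rewrite symmetricmxP; apply/eqP/matrixP => i j; rewrite mxE.
apply: (cvg_near_unique FF _ (cvg_entry FF i j fM) (cvg_entry FF j i fM)).
by apply: filterS fs => k; rewrite symmetricmxP => /eqP E; rewrite {1}E mxE.
Qed.

Section Psd.
Context {R : realType} {n : nat}.
Implicit Types (M G T S : 'M[R]_n) (u : 'cV[R]_n).

Lemma quad_mxinner M u : (u^T *m M *m u) 0 0 = mxinner (u *m u^T) M.
Proof.
by rewrite /mxinner trmx_mul trmxK -[u *m _ *m M]mulmxA mxtrace_mulC /mxtrace big_ord1.
Qed.

Lemma SplusD M N : Splus M -> Splus N -> Splus (M + N).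
Proof.
move=> [Ms Mp] [Ns Np]; split.
  by move: Ms Ns; rewrite !symmetricmxP => /eqP {1}-> /eqP {1}->; rewrite linearD.
by move=> u; rewrite mulmxDr mulmxDl mxE addr_ge0.
Qed.

Lemma SplusZ M a : 0 <= a -> Splus M -> Splus (a *: M).
Proof.
move=> a0 [Ms Mp]; split.
  by move: Ms; rewrite !symmetricmxP => /eqP {1}->; rewrite linearZ.
by move=> u; rewrite -scalemxAr -scalemxAl mxE mulr_ge0.
Qed.

Lemma Splus0 : Splus (0 : 'M[R]_n).
Proof.
split; first by rewrite symmetricmxP trmx0.
by move=> u; rewrite mulmx0 mul0mx mxE.
Qed.

Lemma Splus_rank1 u : Splus (u *m u^T).
Proof.
split; first by rewrite symmetricmxP trmx_mul trmxK.
move=> v; rewrite mulmxA -mulmxA -[v^T *m u]trmxK trmx_mul trmxK mxE big_ord1.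
by rewrite mxE -expr2 sqr_ge0.
Qed.

Lemma Splus_closed_cvg I (F : set_system I) (FF : ProperFilter F)
    (f : I -> 'M[R]_n) M :
  (\forall k \near F, Splus (f k)) -> f @ F --> M -> Splus M.
Proof.
move=> fS fM; split.
  by apply: (symmetric_cvg FF (f := f)) => //; apply: filterS fS => k [].
move=> u; rewrite quad_mxinner.
apply: (cvg_le FF (cvg_cst 0) (cvg_mxinner FF (cvg_cst (u *m u^T)) fM)).
by apply: filterS fS => k [_ /(_ u)]; rewrite quad_mxinner.
Qed.

(** Testing the normal at 0 and at 2 M shows that it is orthogonal to M. *)
Lemma normal_SplusP M S : Splus M -> normal_Splus M S ->
  mxinner S M = 0 /\ forall M', Splus M' -> mxinner S M' <= 0.
Proof.
move=> MS [_ Sn].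
have SM : mxinner S M = 0.
  apply/eqP; rewrite eq_le.
  have := Sn _ (SplusD MS MS); rewrite addrK => ->/=.
  by have := Sn _ Splus0; rewrite sub0r mxinnerNr oppr_le0.
by split=> // M' M'S; have := Sn _ M'S; rewrite mxinnerBr SM subr0.
Qed.

Lemma normal_Sminus M S : Splus M -> normal_Splus M S -> Splus (- S).
Proof.
move=> MS nS; have [_ Sn] := normal_SplusP MS nS; case: nS => Ss _.
split.
  by move: Ss; rewrite !symmetricmxP => /eqP {1}->; rewrite linearN.
by move=> u; rewrite quad_mxinner mxinnerNr oppr_ge0 mxinnerC Sn//; exact: Splus_rank1.
Qed.

Lemma normal_Splus_cvg I (F : set_system I) (FF : ProperFilter F)
    (f h : I -> 'M[R]_n) M S :
  (\forall k \near F, normal_Splus (f k) (h k)) -> f @ F --> M -> h @ F --> S ->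
  normal_Splus M S.
Proof.
move=> fN fM hS; split.
  by apply: (symmetric_cvg FF (f := h)) => //; apply: filterS fN => k [].
move=> M' M'S.
apply: (cvg_le FF (cvg_mxinner FF hS (cvgB (cvg_cst M') fM)) (cvg_cst 0)).
by apply: filterS fN => k [_ ]; apply.
Qed.

Definition mxabs M : R := 1 + \sum_i \sum_j `|M i j|.

Lemma mxabs_gt0 M : 0 < mxabs M.
Proof.
by rewrite ltr_wpDr// sumr_ge0// => i _; apply: sumr_ge0.
Qed.

Lemma quad_le M u : (u^T *m M *m u) 0 0 <= mxabs M * mxinner u u.
Proof.
rewrite quad_mxinner mxinnerE mulrDl mul1r mulr_suml ler_wpDl ?mxinner_ge0//.
apply: ler_sum => i _; rewrite mulr_suml; apply: ler_sum => j _.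
rewrite mxE big_ord1 mxE mulrC; apply: le_trans (ler_norm _) _.
rewrite normrM ler_wpM2l// normrM.
have ui k : `|u k 0| ^+ 2 <= mxinner u u.
  by rewrite real_normK ?num_real// sqr_le_mxinner.
have := ui i; have := ui j; set a := `|u i 0|; set c := `|u j 0|.
by have := sqr_ge0 (a - c); nra.
Qed.

(** With v = M u, expand the nonnegative form of M at c u - v and bound the last
    term by c times the squared norm of v. *)
Lemma Splus_sqr M : Splus M -> Splus (mxabs M *: M - M *m M).
Proof.
move=> [Ms Mp]; have MT : M^T = M by move: Ms; rewrite symmetricmxP => /eqP.
split.
  by rewrite symmetricmxP linearB linearZ /= trmx_mul MT.
move=> u; set c := mxabs M; have c0 : 0 < c := mxabs_gt0 M.
pose v := M *m u.
have uv : (u^T *m M *m v) 0 0 = mxinner v v.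
  by rewrite /mxinner /mxtrace big_ord1 /v trmx_mul MT.
have vu : (v^T *m M *m u) 0 0 = mxinner v v.
  by rewrite -mulmxA /mxinner /mxtrace big_ord1.
have := Mp (c *: u - v); have := quad_le M v; rewrite -/c.
have -> : (u^T *m (c *: M - M *m M) *m u) 0 0 =
    c * (u^T *m M *m u) 0 0 - mxinner v v.
  by rewrite mulmxBr mulmxBl -scalemxAr -scalemxAl -uv /v !mulmxA !mxE.
have -> : ((c *: u - v)^T *m M *m (c *: u - v)) 0 0 = c ^+ 2 * (u^T *m M *m u) 0 0
    - 2 * c * mxinner v v + (v^T *m M *m v) 0 0.
  have mxE2 (A B : 'M[R]_1) : (A - B) 0 0 = A 0 0 - B 0 0 by rewrite !mxE.
  have mxE3 a (A : 'M[R]_1) : (a *: A) 0 0 = a * A 0 0 by rewrite !mxE.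
  have -> : (c *: u - v)^T = c *: u^T - v^T by rewrite linearB linearZ.
  rewrite !mulmxBl !mulmxBr -!scalemxAl -!scalemxAr.
  rewrite !mxE2 !mxE3 uv vu; ring.
set p := (u^T *m M *m u) 0 0; set q := mxinner v v; set s := (v^T *m M *m v) 0 0.
move=> h1 h2; have : 0 <= c * (c * p - q) by nra.
by rewrite pmulr_rge0.
Qed.

Lemma psd_trace_congr M G : Splus M -> 0 <= \tr (G^T *m M *m G).
Proof.
move=> [_ Mp]; rewrite /mxtrace sumr_ge0// => i _.
have := Mp (col i G); rewrite tr_col !mxE.
rewrite (eq_bigr (fun k => (G^T *m M) i k * G k i)) // => k _.
by rewrite !mxE; congr (_ * _); apply: eq_bigr => l _; rewrite !mxE.
Qed.

(** Turns a bound on the trace of G T into a bound of the same order on the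
    square of the product itself: apply the comparison Splus_sqr to T inside
    the trace of G T T G, then to G. The hypothesis on T is self-duality of the
    cone; for minus a normal vector it holds by definition. *)
Lemma psd_mul_le G T : Splus G -> Splus T ->
  (forall M', Splus M' -> 0 <= mxinner T M') ->
  mxinner (G *m T) (G *m T) <= mxabs G * mxabs T * mxinner T G.
Proof.
move=> GS TS Tp; have [Gs _] := GS; have [Ts _] := TS.
move: Gs Ts; rewrite !symmetricmxP => /eqP Gs /eqP Ts.
have h1 := Tp _ (Splus_sqr GS); rewrite mxinnerBr mxinnerZr subr_ge0 in h1.
have E A : A^T = A -> mxinner A (G *m G) = \tr (G^T *m A *m G).
  by move=> As; rewrite /mxinner As -Gs mulmxA mxtrace_mulC mulmxA.
have E1 : mxinner (G *m T) (G *m T) = mxinner (T *m T) (G *m G).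
  rewrite /mxinner !trmx_mul -Gs -Ts.
  by rewrite -!mulmxA mxtrace_mulC -!mulmxA [G *m (G *m _)]mulmxA mxtrace_mulC !mulmxA.
have := psd_trace_congr G (Splus_sqr TS).
rewrite -E; last by rewrite linearB linearZ /= trmx_mul -Ts.
rewrite mxinnerBl mxinnerZl subr_ge0 -E1 => h2.
apply: le_trans h2 _; rewrite [mxabs G * _]mulrC -mulrA.
by rewrite ler_wpM2l// ltW// mxabs_gt0.
Qed.

End Psd.

(** * Sorted spectral decomposition *)

Section Spectral.
Context {R : realType} {n : nat}.
Implicit Types (M P : 'M[R]_n).

(** A Givens rotation (c, s) of the columns i and j. *)
Definition mix_cols P i j (c s : R) : 'M[R]_n :=
  \matrix_(k, l) (if l == i then c * P k i + s * P k j
                  else if l == j then c * P k j - s * P k i else P k l).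

Lemma mix_colsE P i j c s l : i != j -> col l (mix_cols P i j c s) =
  if l == i then c *: col i P + s *: col j P
  else if l == j then c *: col j P - s *: col i P else col l P.
Proof.
move=> ij; apply/colP => k; rewrite !mxE.
by case: ifP => _; [|case: ifP => _]; rewrite !mxE.
Qed.

Lemma congr_entry (N P : 'M[R]_n) k l :
  (P^T *m N *m P) k l = ((col k P)^T *m N *m col l P) 0 0.
Proof.
by rewrite tr_col -row_mul !mxE; apply: eq_bigr => a _; rewrite !mxE.
Qed.

Lemma mix_cols_entry (N P : 'M[R]_n) i j c s k l : i != j ->
  let B := P^T *m N *m P in
  ((mix_cols P i j c s)^T *m N *m mix_cols P i j c s) k l =
  if k == i then
    if l == i then c * (c * B i i + s * B i j) + s * (c * B j i + s * B j j)
    else if l == j then c * (c * B i j - s * B i i) + s * (c * B j j - s * B j i)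
    else c * B i l + s * B j l
  else if k == j then
    if l == i then c * (c * B j i + s * B j j) - s * (c * B i i + s * B i j)
    else if l == j then c * (c * B j j - s * B j i) - s * (c * B i j - s * B i i)
    else c * B j l - s * B i l
  else
    if l == i then c * B k i + s * B k j
    else if l == j then c * B k j - s * B k i
    else B k l.
Proof.
move=> ij; rewrite /= !congr_entry !mix_colsE//.
have aD (A B : 'M[R]_1) : (A + B) 0 0 = A 0 0 + B 0 0 by rewrite !mxE.
have aN (A : 'M[R]_1) : (- A) 0 0 = - A 0 0 by rewrite !mxE.
have aZ a (A : 'M[R]_1) : (a *: A) 0 0 = a * A 0 0 by rewrite !mxE.
have tD (x y : 'cV[R]_n) : (x + y)^T = x^T + y^T by rewrite linearD.
have tN (y : 'cV[R]_n) : (- y)^T = - y^T by rewrite linearN.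
have tZ a (y : 'cV[R]_n) : (a *: y)^T = a *: y^T by rewrite linearZ.
case: ifP => _; [|case: ifP => _]; (case: ifP => _; [|case: ifP => _]);
  rewrite ?(tD, tN, tZ, mulmxDl, mulmxDr, mulNmx, mulmxN) -?scalemxAl
    -?scalemxAr ?(aD, aN, aZ) -?scalemxAl -?scalemxAr ?(aD, aN, aZ); try ring.
Qed.

Lemma orthogonalmx_compact : compact (@orthogonalmx R n).
Proof.
apply: (@mx_compact _ _ _ _ 1) => [F FF FA P FP|P PP i j].
  apply: (@cvg_near_unique R 'M[R]_n _ F FF (fun Q => Q^T *m Q) (fun=> 1%:M)).
  - by apply: filterS FA.
  - by apply: cvg_mulmx => //; exact: cvg_trmx.
  - exact: cvg_cst.
have : (P^T *m P) j j = 1 by rewrite PP mxE eqxx.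
rewrite mxE (bigD1 i)//= mxE -expr2 => E.
rewrite -(@ler_pXn2r _ 2) ?nnegrE// real_normK ?num_real// expr1n -E lerDl.
by apply: sumr_ge0 => k _; rewrite mxE -expr2 sqr_ge0.
Qed.

Lemma mix_cols_orthogonal P i j c s : i != j -> c ^+ 2 + s ^+ 2 = 1 ->
  orthogonalmx P -> orthogonalmx (mix_cols P i j c s).
Proof.
move=> ij cs PP; have ji : (j == i) = false by rewrite eq_sym (negPf ij).
apply/matrixP => k l; have := mix_cols_entry 1%:M P c s k l ij.
rewrite /= !mulmx1 PP => ->; rewrite !mxE !eqxx ji (negPf ij) /=.
case: (eqVneq k i) => [->|ki]; [|case: (eqVneq k j) => [->|kj]];
  (case: (eqVneq l i) => [li|li]; [|case: (eqVneq l j) => [lj|lj]]);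
  rewrite ?li ?lj ?eqxx ?ji ?(negPf ij) ?(eq_sym i l) ?(eq_sym j l) ?(negPf li)
    ?(negPf lj) ?(negPf ki) ?(negPf kj) /=; try ring.
- by rewrite -[RHS]cs; ring.
- by rewrite -[RHS]cs; ring.
Qed.

(** Maximize over the compact orthogonal group the trace of P^T M P weighted by
    strictly decreasing weights. At a maximizer no rotation of two columns
    increases the value; the rotations of small angle force the off-diagonal
    entries to vanish and the quarter turn forces the diagonal to be sorted. *)
Lemma spectral_sorted M : M \is symmetricmx ->
  exists P (l : 'rV[R]_n), [/\ orthogonalmx P,
    forall i j : 'I_n, (i <= j)%N -> l 0 j <= l 0 i & M = P *m diag_mx l *m P^T].
Proof.
rewrite symmetricmxP => /eqP Ms.
pose h (P : 'M[R]_n) : R := \sum_(k < n) (n - k)%:R * (P^T *m M *m P) k k.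
have h_cvg (F : set_system 'M[R]_n) (FF : Filter F) (P : 'M[R]_n) :
    F --> P -> h @ F --> h P.
  move=> FP; apply: cvg_big => [|k _]; first exact: add_continuous.
  apply: cvgM; first exact: cvg_cst.
  apply: (cvg_entry FF); apply: (cvg_mulmx FF) => //.
  by apply: (cvg_mulmx FF); [exact: (cvg_trmx FF)|exact: cvg_cst].
have h_cont : continuous h by move=> P; apply: (h_cvg _ (nbhs_filter P)).
have [||P] := compact_EVT_max (A := @orthogonalmx R n) (f := h) _ orthogonalmx_compact.
- by exists 1%:M; rewrite /orthogonalmx /= trmx1 mul1mx.
- exact: continuous_subspaceT.
rewrite inE => PP Pmax; set B := P^T *m M *m P.
have Bs i j : B i j = B j i.
  by rewrite -[in LHS](trmxK B) mxE {1}/B !trmx_mul trmxK -Ms mulmxA.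
have key (i j : 'I_n) (c s : R) : (i < j)%N -> c ^+ 2 + s ^+ 2 = 1 ->
    s ^+ 2 * (B j j - B i i) + 2 * c * s * B i j <= 0.
  move=> ij cs; have ij' : i != j by rewrite -val_eqE ltn_eqF.
  have ji' : (j == i) = false by rewrite eq_sym (negPf ij').
  have := Pmax (mix_cols P i j c s); rewrite inE => /(_ (mix_cols_orthogonal ij' cs PP)).
  have eN k : k != i -> k != j ->
     ((mix_cols P i j c s)^T *m M *m mix_cols P i j c s) k k = B k k.
    by move=> ki kj; rewrite mix_cols_entry// (negPf ki) (negPf kj).
  have hE Q : h Q = (n - i)%:R * (Q^T *m M *m Q) i i + ((n - j)%:R * (Q^T *m M *m Q) j j
      + \sum_(k < n | (k != i) && (k != j)) (n - k)%:R * (Q^T *m M *m Q) k k).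
    by rewrite /h (bigD1 i)//= (bigD1 j) ?ji'.
  rewrite !hE.
  rewrite (eq_bigr (fun k : 'I_n => (n - k)%:R * B k k)); last first.
    by move=> k /andP[ki kj]; rewrite eN.
  rewrite !addrA lerD2r !mix_cols_entry// !eqxx ji' -/B (Bs j i).
  rewrite !natrB ?(ltnW (ltn_ord _))//.
  have : (i%:R : R) < j%:R by rewrite ltr_nat.
  rewrite -subr_gt0; set x := n%:R - i%:R; set y := n%:R - j%:R => xy h1.
  rewrite -(pmulr_rle0 _ xy); rewrite -subr_le0 in h1; apply: le_trans h1.
  rewrite -subr_le0 (_ : _ - _ = - ((c ^+ 2 + s ^+ 2 - 1) * (x * B i i + y * B j j))).
    by rewrite cs subrr mul0r oppr0.
  by rewrite /x /y; ring.
have key2 (i j : 'I_n) : (i < j)%N -> B i j = 0 /\ B j j <= B i i.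
  move=> ij.
  (* Homogeneity in (c, s) reduces the rotations to c = r, s = 1. *)
  have k2 (r : R) : B j j - B i i + 2 * r * B i j <= 0.
    have nu0 : 0 < Num.sqrt (1 + r ^+ 2) by rewrite sqrtr_gt0 ltr_wpDr ?sqr_ge0.
    set nu := Num.sqrt _ in nu0.
    have nu2 : nu ^+ 2 = 1 + r ^+ 2 by rewrite sqr_sqrtr// addr_ge0 ?sqr_ge0.
    have n0 : nu != 0 by rewrite gt_eqF.
    have cs1 : (r / nu) ^+ 2 + nu^-1 ^+ 2 = 1.
      have -> : (r / nu) ^+ 2 + nu^-1 ^+ 2 = (1 + r ^+ 2) / nu ^+ 2 by field.
      by rewrite -nu2 divff// expf_neq0.
    have := key i j (r / nu) nu^-1 ij cs1.
    have -> : nu^-1 ^+ 2 * (B j j - B i i) + 2 * (r / nu) * nu^-1 * B i j =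
      nu^-1 ^+ 2 * (B j j - B i i + 2 * r * B i j) by field.
    by rewrite pmulr_rle0// exprn_gt0// invr_gt0.
  split; last by have := k2 0; rewrite mulr0 mul0r addr0 subr_le0.
  apply/eqP/negPn/negP => b0.
  have := k2 ((B i i - B j j + 1) / (2 * B i j)).
  have -> : B j j - B i i + 2 * ((B i i - B j j + 1) / (2 * B i j)) * B i j = 1.
    by field.
  by rewrite ler10.
exists P, (\row_i B i i); split => //.
  move=> i j; rewrite leq_eqVlt => /orP[/eqP/val_inj ->//|ij].
  by rewrite [leLHS]mxE [leRHS]mxE; have [] := key2 i j ij.
have -> : diag_mx (\row_i B i i) = B.
  apply/matrixP => i j; rewrite [LHS]mxE [X in X *+ _]mxE.
  case: eqVneq => [->|]; first by rewrite mulr1n.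
  rewrite mulr0n => ij; case: (ltngtP i j) => [|ji|/val_inj E].
  - by move=> /key2[].
  - by rewrite Bs; have [] := key2 j i ji.
  - by rewrite E eqxx in ij.
have PP' : P *m P^T = 1%:M by apply: mulmx1C.
by rewrite /B !mulmxA PP' mul1mx -mulmxA PP' mulmx1.
Qed.

Lemma orthogonalmxC P : orthogonalmx P -> P *m P^T = 1%:M.
Proof. exact: mulmx1C. Qed.

Lemma char_poly_orth P (l : 'rV[R]_n) : orthogonalmx P ->
  char_poly (P *m diag_mx l *m P^T) = \prod_(i < n) ('X - (l 0 i)%:P).
Proof.
move=> PP.
have E : char_poly_mx (P *m diag_mx l *m P^T) =
    map_mx polyC P *m char_poly_mx (diag_mx l) *m map_mx polyC P^T.
  have XE : map_mx polyC P *m 'X%:M *m map_mx polyC P^T = 'X%:M.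
    by rewrite scalar_mxC -mulmxA -map_mxM orthogonalmxC// map_mx1 mulmx1.
  by rewrite /char_poly_mx mulmxBr mulmxBl XE !map_mxM.
rewrite /char_poly E !det_mulmx mulrAC -det_mulmx -map_mxM orthogonalmxC//.
rewrite map_mx1 det1 mul1r -/(char_poly _) char_poly_trig ?diag_mx_is_trig//.
by apply: eq_bigr => i _; rewrite mxE eqxx mulr1n.
Qed.

(** Equal products of linear factors have the same roots up to order, and a
    sorted sequence is determined by its multiset of values. *)
Lemma sorted_roots_eq (l l' : 'rV[R]_n) :
  (forall i j : 'I_n, (i <= j)%N -> l 0 j <= l 0 i) ->
  (forall i j : 'I_n, (i <= j)%N -> l' 0 j <= l' 0 i) ->
  \prod_(i < n) ('X - (l 0 i)%:P) = \prod_(i < n) ('X - (l' 0 i)%:P) -> l = l'.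
Proof.
move=> ls l's ll'.
pose sq (l : 'rV[R]_n) := [seq l 0 i | i <- enum 'I_n].
have sq_sorted (v : 'rV[R]_n) : (forall i j : 'I_n, (i <= j)%N -> v 0 j <= v 0 i) ->
    sorted >=%R (sq v).
  move=> vs; rewrite sorted_map.
  have : sorted (relpre val leq) (enum 'I_n).
    by rewrite -sorted_map val_enum_ord iota_sorted.
  by apply: sub_sorted => i j /= ij; exact: vs.
have sqE : sq l = sq l'.
  apply: (sorted_eq (leT := >=%R)).
  - by move=> y x z xy yz; exact: le_trans yz xy.
  - by move=> x y; rewrite andbC; exact: le_anti.
  - exact: sq_sorted.
  - exact: sq_sorted.
  apply: prod_XsubC_eq; rewrite !big_map.
  by move: ll'; rewrite -!(big_enum _ _ _ (fun i => 'X - _)).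
apply/rowP => i; have nthE (v : 'rV[R]_n) : nth 0 (sq v) i = v 0 i.
  by rewrite /sq (nth_map i) ?size_enum_ord// nth_ord_enum.
by rewrite -!nthE sqE.
Qed.

Lemma eigvalsE P (l : 'rV[R]_n) : orthogonalmx P ->
  (forall i j : 'I_n, (i <= j)%N -> l 0 j <= l 0 i) ->
  eigvals (P *m diag_mx l *m P^T) = l.
Proof.
move=> PP ls; rewrite /eigvals; case: xgetP => [l' _ /= [l's l'E]|/(_ l)].
  by apply: sorted_roots_eq => //; rewrite -l'E char_poly_orth.
by case; split=> //; exact: char_poly_orth.
Qed.

End Spectral.

(** * Common eigenbases of a matrix and a normal vector *)

Section Joint.
Context {R : realType} {n : nat}.
Implicit Types (M P S : 'M[R]_n).

Lemma normal_mul0 M S : Splus M -> normal_Splus M S -> M *m S = 0.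
Proof.
move=> MS nS; have [SM Sn] := normal_SplusP MS nS.
have := psd_mul_le MS (normal_Sminus MS nS).
rewrite !mxinnerNl SM oppr0 mulr0 mulmxN mxinnerNl mxinnerNr opprK => h.
apply: mxinner_eq0; apply/eqP; rewrite eq_le mxinner_ge0 andbT h// => M' M'S.
by rewrite mxinnerNl oppr_ge0 Sn.
Qed.

(** M and S have product 0, so the pieces M p and S p of an eigenvector p of
    M + S are orthogonal. Their squared norms are l times the (nonnegative)
    form of M at p and l times the (nonpositive) form of S at p, so the sign of
    l tells which of them is 0. *)
Lemma normal_eigvec M S (p : 'cV[R]_n) (l : R) :
  Splus M -> normal_Splus M S -> (M + S) *m p = l *: p ->
  M *m p = Num.max l 0 *: p /\ S *m p = Num.min l 0 *: p.
Proof.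
move=> MS nS; rewrite mulmxDl => E.
have MS0 := normal_mul0 MS nS.
have [Ms Mp] := MS; have [_ Sp] := normal_Sminus MS nS.
have MT : M^T = M by move: Ms; rewrite symmetricmxP => /eqP.
have ST : S^T = S by case: nS; rewrite symmetricmxP => /eqP.
have SM0 : S *m M = 0 by rewrite -[S *m M]trmxK trmx_mul MT ST MS0 trmx0.
have [l0|l0] := leP l 0.
  have : mxinner (M *m p) (M *m p) <= 0.
    have -> : mxinner (M *m p) (M *m p) = l * (p^T *m M *m p) 0 0.
      rewrite /mxinner trmx_mul MT /mxtrace big_ord1.
      have -> : p^T *m M *m (M *m p) = l *: (p^T *m M *m p).
        rewrite scalemxAr -E mulmxDr !mulmxA -[X in _ = _ + X *m p]mulmxA MS0.
        by rewrite mulmx0 mul0mx addr0.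
      by rewrite mxE.
    by rewrite mulr_le0_ge0.
  move=> h; have M0 : M *m p = 0.
    by apply: mxinner_eq0; apply/eqP; rewrite eq_le h mxinner_ge0.
  by move: E; rewrite M0 add0r scale0r.
have : mxinner (S *m p) (S *m p) <= 0.
  have -> : mxinner (S *m p) (S *m p) = - (l * (p^T *m (- S) *m p) 0 0).
    rewrite /mxinner trmx_mul ST /mxtrace big_ord1.
    have -> : p^T *m S *m (S *m p) = - (l *: (p^T *m (- S) *m p)).
      rewrite scalemxAr -E mulmxDr !mulmxA mulmxN !mulNmx.
      rewrite -[X in _ = - (- (X *m p) + _)]mulmxA SM0.
      by rewrite mulmx0 mul0mx oppr0 add0r opprK.
    by rewrite !mxE.
  by rewrite oppr_le0 mulr_ge0// ltW.
move=> h; have S0 : S *m p = 0.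
  by apply: mxinner_eq0; apply/eqP; rewrite eq_le h mxinner_ge0.
by move: E; rewrite S0 addr0 scale0r.
Qed.

Definition pos_part (l : 'rV[R]_n) : 'rV[R]_n := \row_i Num.max (l 0 i) 0.
Definition neg_part (l : 'rV[R]_n) : 'rV[R]_n := \row_i Num.min (l 0 i) 0.

Lemma eigdecP M P (d : 'rV[R]_n) : orthogonalmx P ->
  (forall i, M *m col i P = d 0 i *: col i P) -> M = P *m diag_mx d *m P^T.
Proof.
move=> PP Md.
have -> : P *m diag_mx d = M *m P.
  apply/matrixP => k i.
  have : col i (M *m P) = d 0 i *: col i P by rewrite colE -mulmxA -colE.
  by move=> /colP/(_ k); rewrite [LHS]mxE => ->; rewrite mul_mx_diag !mxE mulrC.
by rewrite -mulmxA orthogonalmxC// mulmx1.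
Qed.

Lemma eigdec_col P (d : 'rV[R]_n) i : orthogonalmx P ->
  P *m diag_mx d *m P^T *m col i P = d 0 i *: col i P.
Proof.
move=> PP; rewrite colE !mulmxA -[_ *m P^T *m P]mulmxA PP mulmx1 -mulmxA.
have -> : diag_mx d *m delta_mx i 0 = d 0 i *: delta_mx i 0 :> 'cV[R]_n.
  apply/colP => k; rewrite mul_diag_mx !mxE eqxx andbT.
  by case: eqVneq => [->//|_]; rewrite !mulr0.
by rewrite -scalemxAr.
Qed.

(** A single spectral decomposition of M + S diagonalizes both: the positive
    eigenvalues belong to M and the negative ones to S. *)
Lemma joint_diag M S : Splus M -> normal_Splus M S ->
  exists P (l : 'rV[R]_n), [/\ orthogonalmx P,
    forall i j : 'I_n, (i <= j)%N -> l 0 j <= l 0 i,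
    M = P *m diag_mx (pos_part l) *m P^T & S = P *m diag_mx (neg_part l) *m P^T].
Proof.
move=> MS nS.
have MSs : M + S \is symmetricmx.
  case: MS => + _; case: nS => + _; rewrite !symmetricmxP => /eqP {1}-> /eqP {1}->.
  by rewrite linearD.
have [P [l [PP ls E]]] := spectral_sorted MSs.
exists P, l.
have ev i : (M + S) *m col i P = l 0 i *: col i P by rewrite E eigdec_col.
split => //; apply: eigdecP => // i.
  by have [+ _] := normal_eigvec MS nS (ev i); rewrite mxE.
by have [_] := normal_eigvec MS nS (ev i); rewrite mxE.
Qed.

Lemma pos_part_sorted (l : 'rV[R]_n) :
  (forall i j : 'I_n, (i <= j)%N -> l 0 j <= l 0 i) ->
  (forall i j : 'I_n, (i <= j)%N -> pos_part l 0 j <= pos_part l 0 i).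
Proof.
move=> ls i j /ls lij; rewrite !mxE.
by rewrite ge_max !le_max lij lexx orbT.
Qed.

Lemma neg_part_sorted (l : 'rV[R]_n) :
  (forall i j : 'I_n, (i <= j)%N -> l 0 j <= l 0 i) ->
  (forall i j : 'I_n, (i <= j)%N -> neg_part l 0 j <= neg_part l 0 i).
Proof.
move=> ls i j /ls lij; rewrite !mxE.
by rewrite le_min !ge_min lij lexx orbT.
Qed.

Lemma neg_part_lt0 (l : 'rV[R]_n) i : (neg_part l 0 i < 0) = (l 0 i < 0).
Proof. by rewrite mxE gt_min ltxx orbF. Qed.

Lemma rank_diag_le (d : 'rV[R]_n) :
  (\rank (diag_mx d) <= #|[set i : 'I_n | (d 0 i != 0)%R]%SET|)%N.
Proof.
have -> : diag_mx d = \sum_(i in [set i : 'I_n | (d 0 i != 0)%R]%SET) d 0 i *: delta_mx i i.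
  rewrite (eq_bigl (fun i : 'I_n => d 0 i != 0)); last by move=> i; rewrite inE.
  rewrite big_mkcond /= {1}[diag_mx d](matrix_sum_delta _).
  apply: eq_bigr => i _; rewrite (bigD1 i)//= big1 ?addr0.
    by rewrite mxE eqxx mulr1n; case: eqVneq => [->|//]; rewrite scale0r.
  by move=> j ji; rewrite mxE eq_sym (negPf ji) mulr0n scale0r.
rewrite -sum1_card; elim/big_ind2: _ => [|A k B l Ak Bl|i _]; first by rewrite mxrank0.
  exact: leq_trans (mxrank_add _ _) (leq_add Ak Bl).
by apply: leq_trans (mxrank_scale _ _) _; rewrite mxrank_delta.
Qed.

(** The missing inequality comes from adding a diagonal matrix supported on the
    zero entries, which makes the sum invertible. *)
Lemma rank_diag (d : 'rV[R]_n) : \rank (diag_mx d) = #|[set i : 'I_n | (d 0 i != 0)%R]%SET|.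
Proof.
apply/eqP; rewrite eqn_leq rank_diag_le /=.
pose d' : 'rV[R]_n := \row_i (d 0 i == 0)%:R.
have s0 : [set i : 'I_n | (d' 0 i != 0)%R]%SET = (~: [set i : 'I_n | (d 0 i != 0)%R])%SET.
  apply/setP => i; rewrite !inE mxE negbK.
  by case: (d 0 i == 0); rewrite ?oner_eq0 ?eqxx.
have full : \rank (diag_mx d + diag_mx d')%R = n.
  have -> : diag_mx d + diag_mx d' = diag_mx (d + d').
    by apply/matrixP => i j; rewrite !mxE mulrnDl.
  apply/eqP; rewrite -[_ == _]/(row_free _) row_free_unit unitmxE unitfE det_diag.
  apply/prodf_neq0 => i _; rewrite !mxE.
  by have [->|d0] := eqVneq (d 0 i) 0; rewrite ?eqxx ?add0r ?oner_eq0 ?addr0.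
rewrite -(leq_add2r #|[set i : 'I_n | (d' 0 i != 0)%R]%SET|) {1}s0 cardsC card_ord -{1}full.
exact: leq_trans (mxrank_add _ _) (leq_add (leqnn _) (rank_diag_le d')).
Qed.

Lemma rank_neg_part P (l : 'rV[R]_n) : orthogonalmx P ->
  \rank (P *m diag_mx (neg_part l) *m P^T) = #|[set i : 'I_n | (l 0 i < 0)%R]%SET|.
Proof.
move=> PP; have [Pu PTu] := mulmx1_unit (orthogonalmxC PP).
rewrite mxrankMfree ?row_free_unit// -mxrank_tr trmx_mul mxrankMfree ?row_free_unit//.
rewrite mxrank_tr rank_diag; congr #|pred_of_set _|.
apply/setP => i; rewrite !inE -neg_part_lt0 lt_neqAle.
by rewrite [X in _ && X](_ : _ = true) ?andbT// mxE ge_min lexx orbT.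
Qed.

(** Both sets are final segments of the indices, hence comparable. *)
Lemma upset_sub (a c : 'rV[R]_n) :
  (forall i j : 'I_n, (i <= j)%N -> a 0 j <= a 0 i) ->
  (forall i j : 'I_n, (i <= j)%N -> c 0 j <= c 0 i) ->
  (#|[set i : 'I_n | (a 0 i < 0)%R]%SET| <= #|[set i : 'I_n | (c 0 i < 0)%R]%SET|)%N ->
  ([set i : 'I_n | (a 0 i < 0)%R] \subset [set i : 'I_n | (c 0 i < 0)%R])%SET.
Proof.
move=> as_ cs_ ac; apply/fintype.subsetP => i; rewrite !inE => ai; rewrite ltNge.
apply/negP => ci; move: ac; rewrite leqNgt => /negP; apply; apply: proper_card.
rewrite properE; apply/andP; split.
  apply/fintype.subsetP => j; rewrite !inE => cj; apply: le_lt_trans ai; apply: as_.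
  by rewrite leqNgt; apply/negP => ji; move: (le_lt_trans (cs_ j i (ltnW ji)) cj); rewrite ltNge ci.
by apply/fintype.subsetPn; exists i; rewrite !inE ?ai// -leNgt.
Qed.

(** The change of basis commutes with the diagonal matrix of eigenvalues, so
    its entries between different eigenvalues vanish. *)
Lemma eigenbases_block M P P' : eigenbases M P -> eigenbases M P' ->
  block_orthogonal M (P^T *m P').
Proof.
move=> [PP ME] [P'P' ME']; set Q := P^T *m P'.
have QQ : Q^T *m Q = 1%:M.
  by rewrite trmx_mul trmxK mulmxA -[P'^T *m P *m _]mulmxA orthogonalmxC// mulmx1 P'P'.
have Q0 i j : eigvals M 0 i != eigvals M 0 j -> Q i j = 0.
  move=> ij; have DQ : diag_mx (eigvals M) *m Q = Q *m diag_mx (eigvals M).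
    have h1 : M *m P' = P' *m diag_mx (eigvals M).
      by rewrite {1}ME' -mulmxA P'P' mulmx1.
    have h2 : P^T *m M = diag_mx (eigvals M) *m P^T.
      by rewrite {1}ME !mulmxA PP mul1mx.
    by rewrite /Q -mulmxA -h1 !mulmxA h2.
  have := congr1 (fun A : 'M[R]_n => A i j) DQ; rewrite /= mul_diag_mx mul_mx_diag [LHS]mxE [RHS]mxE.
  rewrite mulrC => /eqP; rewrite -subr_eq0 -mulrBr mulf_eq0 subr_eq0 (negPf ij) orbF.
  by move=> /eqP.
exists (fun j => mxblk Q (eig_class j) (eig_class j)); split=> //.
  move=> j; apply/matrixP => a c.
  have QQe x y : \sum_z Q z x * Q z y = (x == y)%:R.
    have := congr1 (fun A : 'M[R]_n => A x y) QQ; rewrite /= mxE [RHS]mxE => <-.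
    by apply: eq_bigr => z _; rewrite [Q^T x z]mxE.
  rewrite mxE [RHS]mxE -(inj_eq enum_val_inj) -QQe.
  rewrite [RHS](bigID (mem (eig_class j))) /= [X in _ = _ + X]big1 ?addr0.
    rewrite [RHS]big_enum_val /=; apply: eq_bigr => b _.
    by rewrite mxE /mxblk [mxsub _ _ _ b a]mxE [mxsub _ _ _ b c]mxE.
  move=> b bj; rewrite (Q0 b (enum_val c)) ?mulr0//.
  by have := enum_valP c; move: bj; rewrite !inE => bj /eqP ->.
move=> j k jk; apply/matrixP => a c; rewrite mxE [RHS]mxE Q0//.
have := enum_valP a; have := enum_valP c; rewrite !inE => /eqP -> /eqP ->.
rewrite nth_uniq ?(ltn_ord)//.
by rewrite sort_uniq undup_uniq.
Qed.

End Joint.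

(** * A criterion for membership in Upsilon *)

Section UpsilonSection.
Context {R : realType} {X : euclideanType R} {n : nat}.

(** Take beta_+ = beta, beta_- and beta_0 empty and the enlarged gamma equal to
    gamma, so that only the columns of W indexed by gamma have to vanish. In a
    common eigenbasis of g x and S' these columns span part of the range of S',
    because gamma is a final segment of at most rank S' indices; and the
    differential at w kills that range. *)
Lemma in_Upsilon (g : X -> 'M[R]_n) (x w : X) (S S' : 'M[R]_n) :
  Splus (g x) -> normal_Splus (g x) S -> normal_Splus (g x) S' ->
  (\rank S <= \rank S')%N -> 'd g x w *m S' = 0 -> Upsilon g x S w.
Proof.
move=> gS nS nS' rk DS'.
have [P [l [PP ls ME SE]]] := joint_diag gS nS.
have [P' [l' [P'P' l's ME' SE']]] := joint_diag gS nS'.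
have eM : eigvals (g x) = pos_part l by rewrite ME eigvalsE//; exact: pos_part_sorted.
have eM' : eigvals (g x) = pos_part l' by rewrite ME' eigvalsE//; exact: pos_part_sorted.
have eS : eigvals S = neg_part l by rewrite SE eigvalsE//; exact: neg_part_sorted.
have gsub : ([set i : 'I_n | (l 0 i < 0)%R] \subset [set i : 'I_n | (l' 0 i < 0)%R])%SET.
  by apply: upset_sub => //; rewrite -(rank_neg_part l PP) -(rank_neg_part l' P'P') -SE -SE'.
have DP' k i : i \in gamma_idx S -> ('d g x w *m P') k i = 0.
  rewrite inE eS neg_part_lt0 => li.
  have l'i : neg_part l' 0 i != 0.
    rewrite lt_eqF// neg_part_lt0.
    by move/fintype.subsetP/(_ i): gsub; rewrite !inE; apply.
  have : 'd g x w *m P' *m diag_mx (neg_part l') = 0.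
    have -> : 'd g x w *m P' *m diag_mx (neg_part l') = 'd g x w *m S' *m P'.
      by rewrite SE' !mulmxA -[_ *m P'^T *m P']mulmxA P'P' mulmx1.
    by rewrite DS' mul0mx.
  move=> /matrixP/(_ k i); rewrite mul_mx_diag mxE [RHS]mxE => /eqP.
  by rewrite mulf_eq0 (negPf l'i) orbF => /eqP.
have PQ : P *m (P^T *m P') = P' by rewrite mulmxA orthogonalmxC// mul1mx.
have W0 (W := (P *m (P^T *m P'))^T *m 'd g x w *m (P *m (P^T *m P'))) J :
    mxblk W J (gamma_idx S) = 0.
  apply/matrixP => a c; rewrite mxE [RHS]mxE /W PQ -mulmxA mxE big1// => k _.
  by rewrite DP' ?mulr0//; exact: enum_valP.
have ebP : eigenbases (g x) P by split=> //; rewrite eM.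
have ebP' : eigenbases (g x) P' by split=> //; rewrite eM'.
exists finset.set0, (beta_idx (g x) S), finset.set0, (gamma_idx S), P, (P^T *m P').
split.
- exact: fintype.subxx.
- by split; [exact: ebP|split; [exact: PP|rewrite eS; exact: SE]].
- exact: eigenbases_block.
split.
- by rewrite finset.setDv !finset.setU0 finset.set0U.
- exact: W0.
- have no (i : 'I_#|@finset.set0 'I_n|) : False by have := enum_valP i; rewrite inE.
  split; first by rewrite symmetricmxP; apply/eqP/matrixP => i; case: (no i).
  by move=> u; rewrite mxE big1// => i; case: (no i).
- by rewrite !finset.set0U; exact: W0.
Qed.

End UpsilonSection.

(** * Penalization of the constraints *)

Section Multipliers.
Context {R : realType} {X : euclideanType R} {m n : nat}.
Variables (A : {linear X -> 'cV[R]_m}) (b : 'cV[R]_m) (g : X -> 'M[R]_n).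

(** Keeping Y as a variable, instead of minimizing it out as a distance to the
    cone, makes the penalty differentiable in u and its stationarity in Y the
    definition of a normal vector. *)
Definition penalty (u : X) (Y : 'M[R]_n) : R :=
  mxinner (A u - b) (A u - b) + mxinner (g u - Y) (g u - Y).

Lemma penalty_ge0 u Y : 0 <= penalty u Y.
Proof. by rewrite addr_ge0 ?mxinner_ge0. Qed.

(** The only consequence of metric regularity used below: the distance to the
    feasible set is at most kappa times the residual. The distance is replaced
    by its lower bounds a. *)
Lemma metric_bound (xs : X) :
  metrically_regular range_norm range_space (constraint_map A b g) xs (0, 0) ->
  exists delta kappa : R, [/\ 0 < delta, 0 < kappa &
    forall u, `|u - xs| <= delta -> forall Y, Splus Y -> forall a : R,
      (forall p, feasible A b g p -> a <= `|u - p|) ->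
      a <= kappa * Num.sqrt (penalty u Y)].
Proof.
move=> [_ [delta [kappa [d0 k0 H]]]]; exists delta, kappa; split => // u ud Y YS a ap.
have := H u (0, 0); rewrite /range_space /= symmetricmxP trmx0 eqxx => /(_ isT).
have rn0 : range_norm ((0, 0) - (0, 0) : 'cV[R]_m * 'M[R]_n) = 0.
  by rewrite subrr /range_norm /= !mxinner0r addr0 sqrtr0.
rewrite rn0 expr0n addr0 sqrtr_sqr ger0_norm// => /(_ ud) h.
rewrite -lee_fin; apply: (@le_trans _ _ (edistance (fun u : X => `|u|%R) u
    [set u | constraint_map A b g u (0, 0)])).
  apply: le_ereal_inf_tmp => _ [p [Y' Y'S E] <-]; rewrite lee_fin.
  apply: ap; move: E => [] E1 E2; split.
    by apply/eqP; rewrite -subr_eq0 -[A p - b]subr0 E1.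
  by move/eqP: E2; rewrite subr_eq0 => /eqP ->.
apply: le_trans h _; rewrite EFinM lee_pmul2l ?lte_fin//.
apply: ereal_inf_lbound; exists ((A u - b, g u) - (0, Y)); first by exists Y.
congr EFin; rewrite /range_norm /penalty /=.
by rewrite !sub0r subr0 !mxinnerNl !mxinnerNr !opprK.
Qed.

Lemma small_le (a q tau : R) : 0 < tau -> 0 <= q ->
  (forall t, 0 < t < tau -> a <= t * q) -> a <= 0.
Proof.
move=> tau0 q0 H; rewrite leNgt; apply/negP => a0.
pose t := Num.min (tau / 2) (a / 2 / (q + 1)).
have q1 : 0 < q + 1 by lra.
have t0 : 0 < t by rewrite lt_min !divr_gt0.
have tt : t < tau by rewrite gt_min; apply/orP; left; lra.
have := H t; rewrite t0 tt => /(_ isT); apply/negP; rewrite -ltNge.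
apply: (@le_lt_trans _ _ (a / 2 / (q + 1) * (q + 1))); last by rewrite divfK ?gt_eqF//; lra.
apply: (@le_trans _ _ (t * (q + 1))); first by rewrite ler_pM2l//; lra.
by rewrite ler_pM2r// ge_min lexx orbT.
Qed.

Lemma cvg_linear T (F : set_system T) (FF : Filter F) p q
    (L : {linear X -> 'M[R]_(p, q)}) (f : T -> X) x :
  f @ F --> x -> (fun k => L (f k)) @ F --> L x.
Proof.
move=> fx.
have LE y : L y = \sum_j v2r y 0 j *: L (r2v (delta_mx 0 j)).
  by rewrite {1}(r2v_sum y) linear_sum; apply: eq_bigr => j _; rewrite linearZ.
rewrite LE (_ : (fun k => _) = fun k => \sum_j v2r (f k) 0 j *: L (r2v (delta_mx 0 j))).
  apply: cvg_big => [|j _]; first exact: add_continuous.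
  by apply: cvgZr_tmp; exact: cvg_coord.
by apply/funext => k; exact: LE.
Qed.

Lemma mxinner_sqD p q (M N : 'M[R]_(p, q)) :
  mxinner (M + N) (M + N) = mxinner M M + 2 * mxinner M N + mxinner N N.
Proof. by rewrite !mxinnerDl !mxinnerDr (mxinnerC N M); ring. Qed.

(** At t > 0 the increment of F divided by t is an explicit continuous
    expression in the difference quotient of g; let t tend to 0. *)
Lemma penalty_stationary (v x1 u d : X) (Y : 'M[R]_n) (c tau : R) :
  differentiable g u -> 0 < tau ->
  let F z := - inner v (z - x1) + c / 2 * penalty z Y + 2^-1 * `|z - x1| ^+ 2 in
  (forall t, 0 < t < tau -> F u <= F (u + t *: d)) ->
  0 <= - inner v d + mxinner (c *: (A u - b)) (A d)
       + mxinner (c *: (g u - Y)) ('d g u d) + inner (u - x1) d.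
Proof.
move=> gu tau0 F Fmin.
pose D (t : R) : 'M[R]_n := t^-1 *: (g (u + t *: d) - g u).
pose Q (t : R) := (- inner v d + mxinner (c *: (A u - b)) (A d)
   + mxinner (c *: (g u - Y)) (D t) + inner (u - x1) d)
   + t * (c / 2 * mxinner (A d) (A d) + c / 2 * mxinner (D t) (D t) + 2^-1 * `|d| ^+ 2).
have FQ t : 0 < t -> F (u + t *: d) - F u = t * Q t.
  move=> t0.
  have gE : g (u + t *: d) - Y = (g u - Y) + t *: D t.
    by rewrite /D scalerA divff ?gt_eqF// scale1r [RHS]addrC addrA subrK.
  have AE : A (u + t *: d) - b = (A u - b) + t *: A d.
    by rewrite linearD linearZ /= addrAC.
  have xE : u + t *: d - x1 = (u - x1) + t *: d by rewrite addrAC.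
  rewrite /F /penalty gE AE xE !mxinner_sqD -!inner_sqr /Q -!inner_sqr.
  move: (u - x1) (D t) (g u - Y) (A u - b) (A d) => x' D' G' a' a1.
  rewrite !innerDl !innerDr !innerZl !innerZr !mxinnerZl !mxinnerZr (innerC d x').
  by field.
have Dd : D @ 0^'+ --> 'd g u d by exact: diff_quotient_cvg.
have t0' : (fun t : R => t) @ 0^'+ --> (0 : R) by exact: cvg_at_right_filter.
have Qc : Q @ 0^'+ --> (- inner v d + mxinner (c *: (A u - b)) (A d)
       + mxinner (c *: (g u - Y)) ('d g u d) + inner (u - x1) d)
  + 0 * (c / 2 * mxinner (A d) (A d) + c / 2 * mxinner ('d g u d) ('d g u d) + 2^-1 * `|d| ^+ 2).
  apply: cvgD.
    apply: cvgD; last exact: cvg_cst.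
    apply: cvgD; first exact: cvg_cst.
    by apply: cvg_mxinner => //; exact: cvg_cst.
  apply: cvgM => //; apply: cvgD; last exact: cvg_cst.
  apply: cvgD; first exact: cvg_cst.
  by apply: cvgM; [exact: cvg_cst|exact: cvg_mxinner].
rewrite mul0r addr0 in Qc.
apply: (@cvg_le R R 0^'+ _ (fun=> 0) Q _ _ _ Qc); first exact: cvg_cst.
near=> t.
have t0 : 0 < t by near: t; exact: nbhs_right_gt.
have tt : t < tau by near: t; exact: nbhs_right_lt.
have := Fmin t; rewrite t0 tt => /(_ isT).
by rewrite -subr_ge0 FQ// pmulr_rge0.
Unshelve. all: by end_near. Qed.

End Multipliers.

(** * Bounded multipliers from metric regularity *)

Section MultiplierBound.
Context {R : realType} {X : euclideanType R} {m n : nat}.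
Variables (A : {linear X -> 'cV[R]_m}) (b : 'cV[R]_m) (g : X -> 'M[R]_n).
Hypothesis (g_sym : forall x, g x \is symmetricmx).
Hypothesis (g_C2 : C2_on [set: X] g).

Definition penalized (v x1 : X) (c : R) (u : X) (Y : 'M[R]_n) : R :=
  - inner v (u - x1) + c / 2 * penalty A b g u Y + 2^-1 * `|u - x1| ^+ 2.

Lemma penalized_min (v x1 : X) (c r : R) : 0 <= r -> Splus (g x1) ->
  exists u Y, [/\ `|u - x1| <= r, Splus Y, `|Y - g x1| <= 1 &
    forall u' Y', `|u' - x1| <= r -> Splus Y' -> `|Y' - g x1| <= 1 ->
      penalized v x1 c u Y <= penalized v x1 c u' Y'].
Proof.
move=> r0 gx1.
pose K1 := [set u : X | `|u - x1| <= r].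
pose K2 := [set Y : 'M[R]_n | Splus Y /\ `|Y - g x1| <= 1].
have K1c : compact K1.
  apply: (@euclid_compact _ _ _ (r + `|x1|)) => [F FF FK l Fl|x K1x].
    apply: (@cvg_le R X F _ (fun u => `|u - x1|) (fun=> r)) => //.
      by apply: cvg_norm; apply: cvgB => //; exact: cvg_cst.
    exact: cvg_cst.
  by rewrite -[x](subrK x1); apply: le_trans (ler_normD _ _) _; rewrite lerD2r.
have K2c : compact K2.
  apply: (@mx_compact _ _ _ _ (1 + `|g x1|)) => [F FF FK l Fl|Y [_ YK] i j].
    split; first by apply: (@Splus_closed_cvg _ _ _ F _ id) => //; apply: filterS FK => ? [].
    apply: (@cvg_le R _ F _ (fun Y => `|Y - g x1|) (fun=> 1)) => //.
    - by apply: cvg_norm; apply: cvgB => //; exact: cvg_cst.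
    - exact: cvg_cst.
    - by apply: filterS FK => ? [].
  apply: le_trans (le_mx_norm _ i j) _.
  by rewrite -[Y](subrK (g x1)); apply: le_trans (ler_normD _ _) _; rewrite lerD2r.
pose F2 (p : X * 'M[R]_n) := penalized v x1 c p.1 p.2.
have F2_cvg (F : set_system (X * 'M[R]_n)) (FF : Filter F) p : F --> p -> F2 @ F --> F2 p.
  move=> Fp.
  have f1 : (fun q : X * 'M[R]_n => q.1) @ F --> p.1 by apply: cvg_trans (cvg_app fst Fp) cvg_fst.
  have f2 : (fun q : X * 'M[R]_n => q.2) @ F --> p.2 by apply: cvg_trans (cvg_app snd Fp) cvg_snd.
  have f1' : (fun q : X * 'M[R]_n => q.1 - x1) @ F --> p.1 - x1.
    by apply: cvgB => //; exact: cvg_cst.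
  apply: cvgD.
    apply: cvgD; first by apply: cvgN; apply: cvg_inner => //; exact: cvg_cst.
    apply: cvgM; first exact: cvg_cst.
    have a1 : (fun q : X * 'M[R]_n => A q.1 - b) @ F --> A p.1 - b.
      by apply: cvgB; [exact: cvg_linear|exact: cvg_cst].
    have a2 : (fun q : X * 'M[R]_n => g q.1 - q.2) @ F --> g p.1 - p.2.
      by apply: cvgB => //; exact: (C2_cvg g_C2).
    by apply: cvgD; apply: cvg_mxinner.
  apply: cvgM; first exact: cvg_cst.
  rewrite -inner_sqr (_ : (fun q : X * 'M[R]_n => _) = fun q => inner (q.1 - x1) (q.1 - x1)).
    exact: cvg_inner.
  by apply/funext => q; rewrite inner_sqr.
have [||[u Y]] := compact_EVT_min (f := F2) _ (compact_setX K1c K2c).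
- by exists (x1, g x1); rewrite /K1 /K2; split; rewrite /= subrr normr0.
- by apply: continuous_subspaceT => p; apply: (F2_cvg _ (nbhs_filter p)).
rewrite inE => -[/= K1u [YS YK]] H; exists u, Y; split => // u' Y' h1 h2 h3.
by apply: (H (u', Y')); rewrite inE.
Qed.

Lemma sqr_cvg0 T (F : set_system T) (FF : Filter F) (V : normedModType R)
    (f : T -> V) (x : V) (q : T -> R) :
  (\forall k \near F, `|f k - x| ^+ 2 <= q k) -> q @ F --> 0 -> f @ F --> x.
Proof.
move=> fq q0; apply/cvgrPdistC_lt => e e0.
have e2 : 0 < e ^+ 2 by rewrite exprn_gt0.
move/cvgr_lt : q0 => /(_ _ e2) q0; near=> k.
rewrite -(@ltr_pXn2r _ 2) ?nnegrE// ?(ltW e0)//.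
by apply: (@le_lt_trans _ _ (q k)); near: k.
Unshelve. all: by end_near. Qed.

(** Exact penalization. Minimize the penalized linear function - <v, .> near x1
    with a weight c tending to infinity. By metric_bound, - <v, .> decreases at most by a multiple of
    the residual psi away from the feasible set, so c psi stays bounded by
    2 kappa |v|; hence the minimizers tend to x1 and the scaled residuals are
    bounded approximate multipliers, whose limits are multipliers. *)
Lemma multiplier_bound (xs : X) :
  metrically_regular range_norm range_space (constraint_map A b g) xs (0, 0) ->
  exists r C : R, [/\ 0 < r, 0 <= C &
    forall x1, `|x1 - xs| < r -> feasible A b g x1 ->
    forall v, normal_cone (feasible A b g) x1 v ->
    exists y S, [/\ normal_Splus (g x1) S,
      forall d, inner v d = mxinner y (A d) + mxinner S ('d g x1 d),
      forall i j, `|y i j| <= C * `|v| & forall i j, `|S i j| <= C * `|v|]].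
Proof.
move=> /metric_bound[delta [kappa [d0 k0 Hmr]]].
pose r := delta / 2; have r0 : 0 < r by rewrite divr_gt0.
exists r, (2 * kappa); split => //; first by rewrite mulr_ge0// ltW.
move=> x1 x1r [Ax1 gx1] v vN.
have /choice[uY uYP] (k : nat) : exists p : X * 'M[R]_n,
    [/\ `|p.1 - x1| <= r, Splus p.2, `|p.2 - g x1| <= 1 &
    forall u' Y', `|u' - x1| <= r -> Splus Y' -> `|Y' - g x1| <= 1 ->
      penalized v x1 k.+1%:R p.1 p.2 <= penalized v x1 k.+1%:R u' Y'].
  by have [u [Y H]] := penalized_min v k.+1%:R (ltW r0) gx1; exists (u, Y).
pose u k := (uY k).1; pose Y k := (uY k).2; pose c (k : nat) : R := k.+1%:R.
have c0 k : 0 < c k by rewrite ltr0n.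
pose psi k := Num.sqrt (penalty A b g (u k) (Y k)).
have psi2 k : psi k ^+ 2 = penalty A b g (u k) (Y k) by rewrite sqr_sqrtr// penalty_ge0.
have psi0 k : 0 <= psi k by exact: sqrtr_ge0.
(* v is normal at x1, so <v, u - x1> <= <v, u - p> for every feasible p. *)
have vu k : inner v (u k - x1) <= `|v| * (kappa * psi k).
  have [v0|v0] := eqVneq v 0; first by rewrite v0 inner0l normr0 mul0r.
  have nv : 0 < `|v| by rewrite normr_gt0.
  rewrite -ler_pdivrMl//; have [h1 h2 _ _] := uYP k.
  apply: Hmr => //.
    have -> : u k - xs = (u k - x1) + (x1 - xs) by rewrite addrA subrK.
    by apply: le_trans (ler_normD _ _) _; rewrite (splitr delta) lerD// ltW.
  move=> p /vN pN; rewrite ler_pdivrMl//.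
  have -> : u k - x1 = (u k - p) + (p - x1) by rewrite addrA subrK.
  by rewrite innerDr; have := inner_le v (u k - p); lra.
(* The minimum is at most the value 0 taken at (x1, g x1). *)
have key k : c k / 2 * psi k ^+ 2 + 2^-1 * `|u k - x1| ^+ 2 <= `|v| * (kappa * psi k).
  have [_ _ _ /(_ x1 (g x1))] := uYP k.
  rewrite !subrr !normr0 ltW// => /(_ isT gx1 ler01).
  rewrite {2}/penalized /penalty Ax1 !subrr !mxinner0r inner0r normr0 expr0n /=.
  rewrite -/(penalty A b g x1 _) /penalized -/(u k) -/(Y k) -psi2 -/(c k).
  by have := vu k; lra.
have v0 := normr_ge0 v.
have cpsi k : c k * psi k <= 2 * kappa * `|v|.
  have [->|p0] := eqVneq (psi k) 0; first by rewrite mulr0 !mulr_ge0// ltW.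
  have pp : 0 < psi k by rewrite lt_neqAle eq_sym p0 psi0.
  rewrite -(ler_pM2r pp); have := key k; have := sqr_ge0 `|u k - x1|; lra.
have [U [UU UO]] := ultraFilterLemma (eventually_filter : ProperFilter \oo).
have cinv : (fun k => (c k)^-1) @ U --> (0 : R).
  by apply: cvg_trans (@cvg_harmonic R); exact: cvg_app.
have psi_c : psi @ U --> (0 : R).
  apply: (@squeeze_cvgr _ _ _ _ (fun=> 0) (fun k => 2 * kappa * `|v| * (c k)^-1)).
  - by apply: nearW => k; rewrite psi0 /= ler_pdivlMr// mulrC.
  - exact: cvg_cst.
  - by rewrite -[X in _ --> X](mulr0 (2 * kappa * `|v|)); apply: cvgM => //; exact: cvg_cst.
have u_c : u @ U --> x1.
  apply: (@sqr_cvg0 _ _ _ _ _ _ (fun k => 2 * `|v| * kappa * psi k)).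
    by apply: nearW => k; have := key k; have := mulr_ge0 (ltW (c0 k)) (sqr_ge0 (psi k)); lra.
  rewrite -[X in _ --> X](mulr0 (2 * `|v| * kappa)).
  by apply: cvgM => //; exact: cvg_cst.
have gY_le k i j : `|(g (u k) - Y k) i j| <= psi k.
  rewrite -(@ler_pXn2r _ 2) ?nnegrE// real_normK ?num_real// psi2.
  by apply: le_trans (sqr_le_mxinner _ i j) _; rewrite /penalty lerDr mxinner_ge0.
have Ab_le k i j : `|(A (u k) - b) i j| <= psi k.
  rewrite -(@ler_pXn2r _ 2) ?nnegrE// real_normK ?num_real// psi2.
  by apply: le_trans (sqr_le_mxinner _ i j) _; rewrite /penalty lerDl mxinner_ge0.
have Y_c : Y @ U --> g x1.
  have -> : Y = fun k => g (u k) - (g (u k) - Y k) by apply/funext => k; rewrite subKr.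
  rewrite -[g x1]subr0; apply: cvgB; first exact: (C2_cvg g_C2).
  apply: cvg_mx => i j; rewrite mxE; apply: norm_cvg0.
  apply: (@squeeze_cvgr _ _ _ _ (fun=> 0) psi) => //; last exact: cvg_cst.
  by apply: nearW => k; rewrite normr_ge0 /= gY_le.
pose y k := c k *: (A (u k) - b); pose S k := c k *: (g (u k) - Y k).
have y_le k i j : `|y k i j| <= 2 * kappa * `|v|.
  rewrite /y mxE normrM gtr0_norm//; apply: le_trans (cpsi k).
  by rewrite ler_pM2l// Ab_le.
have S_le k i j : `|S k i j| <= 2 * kappa * `|v|.
  rewrite /S mxE normrM gtr0_norm//; apply: le_trans (cpsi k).
  by rewrite ler_pM2l// gY_le.
have [yl yc] := @mx_ultra_cvg _ _ U UU _ _ y (2 * kappa * `|v|) (fun i j => nearW _ (fun k => y_le k i j)).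
have [Sl Sc] := @mx_ultra_cvg _ _ U UU _ _ S (2 * kappa * `|v|) (fun i j => nearW _ (fun k => S_le k i j)).
have entry_le p q (f : nat -> 'M[R]_(p, q)) (l : 'M[R]_(p, q)) (C : R) :
    (forall k i j, `|f k i j| <= C) -> f @ U --> l -> forall i j, `|l i j| <= C.
  move=> fC fl i j; apply: (@cvg_le R _ U _ (fun k => `|f k i j|) (fun=> C)).
  - by apply: cvg_norm; apply: cvg_entry.
  - exact: cvg_cst.
  - exact: nearW.
exists yl, Sl; split; last 2 first.
- exact: entry_le yc.
- exact: entry_le Sc.
- apply: (@normal_Splus_cvg _ _ _ U _ Y S) => //.
  (* Once Y k is interior to the unit ball it may move slightly towards any
     point of the cone. *)
  have Yn : \forall k \near U, `|Y k - g x1| < 1.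
    by move/cvgrPdistC_lt : Y_c; apply.
  apply: filterS Yn => k Yk.
  have YS : Splus (Y k) by have [] := uYP k.
  split.
    have [+ _] := YS; have := g_sym (u k); rewrite !symmetricmxP => /eqP gE /eqP YE.
    have -> : (S k)^T = c k *: ((g (u k))^T - (Y k)^T) by rewrite /S linearZ /= linearB.
    by rewrite -gE -YE.
  move=> Y' Y'S; rewrite mxinnerZl pmulr_rle0//.
  pose D := Y' - Y k.
  have D1 : 0 < `|D| + 1 by rewrite ltr_wpDl.
  rewrite -(pmulr_rle0 _ (ltr0Sn R 1)).
  apply: (@small_le _ _ (mxinner D D) (Num.min 1 ((1 - `|Y k - g x1|) / (`|D| + 1)))).
  - by rewrite lt_min ltr01 divr_gt0// subr_gt0.
  - exact: mxinner_ge0.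
  move=> t /andP[t0]; rewrite lt_min => /andP[t1]; rewrite ltr_pdivlMr// => tD.
  have [Yk1 _ _ /(_ (u k) (Y k + t *: D))] := uYP k.
  move=> /(_ Yk1); have -> : Y k + t *: D = (1 - t) *: Y k + t *: Y'.
    by rewrite /D scalerBr scalerBl scale1r addrA addrAC.
  have YtS : Splus ((1 - t) *: Y k + t *: Y').
    by apply: SplusD; apply: SplusZ => //; lra.
  move=> /(_ YtS); have Yt : (1 - t) *: Y k + t *: Y' = Y k + t *: D.
    by rewrite /D scalerBr scalerBl scale1r addrA addrAC.
  have Yt1 : `|(1 - t) *: Y k + t *: Y' - g x1| <= 1.
    rewrite Yt addrAC; apply: le_trans (ler_normD _ _) _.
    by rewrite normrZ gtr0_norm//; have := normr_ge0 D; nra.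
  move=> /(_ Yt1); rewrite -/(u k) -/(Y k) Yt /penalized lerD2r lerD2l -/(c k).
  rewrite ler_pM2l ?divr_gt0// /penalty lerD2l.
  rewrite opprD addrA (mxinner_sqD _ (- (t *: D))) !mxinnerNr mxinnerNl opprK.
  rewrite !mxinnerZl !mxinnerZr -subr_ge0 -/D => h.
  by rewrite -(ler_pM2l t0); move: h; lra.
move=> d.
have st e : 0 <= - inner v e + mxinner yl (A e) + mxinner Sl ('d g x1 e).
  have un : \forall k \near U, `|u k - x1| < r by move/cvgrPdistC_lt : u_c; apply.
  rewrite -[leRHS]addr0 -[X in _ + X](inner0l e).
  apply: (@cvg_le R _ U _ (fun=> 0) (fun k => - inner v e + mxinner (y k) (A e) +
     mxinner (S k) ('d g (u k) e) + inner (u k - x1) e)).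
  - exact: cvg_cst.
  - apply: cvgD.
      apply: cvgD.
        by apply: cvgD; [exact: cvg_cst|apply: cvg_mxinner => //; exact: cvg_cst].
      by apply: cvg_mxinner => //; exact: (C2_diff_cvg g_C2).
    rewrite -[X in inner X e](subrr x1).
    by apply: cvg_inner; [apply: cvgB => //; exact: cvg_cst|exact: cvg_cst].
  apply: filterS un => k uk.
  have e1 : 0 < `|e| + 1 by rewrite ltr_wpDl.
  apply: (@penalty_stationary _ _ _ _ A b g v x1 (u k) e (Y k) (c k)
    ((r - `|u k - x1|) / (`|e| + 1))) => //.
    by case: g_C2 => + _ _; apply.
    by rewrite divr_gt0// subr_gt0.
  move=> t /andP[t0]; rewrite ltr_pdivlMr// => te.
  have [h1 h2 h3 /(_ (u k + t *: e) (Y k))] := uYP k; apply => //.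
  rewrite addrAC; apply: le_trans (ler_normD _ _) _.
  by rewrite normrZ gtr0_norm//; have := normr_ge0 e; nra.
apply/eqP; rewrite eq_le; apply/andP; split; first by have := st d; lra.
have := st (- d); rewrite innerNr [A _]linearN [X in mxinner Sl X]linearN !mxinnerNr; lra.
Qed.

End MultiplierBound.

(** * Convexity of the constraints *)

Section Convexity.
Context {R : realType} {X : euclideanType R} {m n : nat}.
Variables (A : {linear X -> 'cV[R]_m}) (b : 'cV[R]_m) (g : X -> 'M[R]_n).
Hypothesis (g_sym : forall x, g x \is symmetricmx).
Hypothesis (g_C2 : C2_on [set: X] g) (g_convex : Sminus_convex g).

Let g_diff x : differentiable g x. Proof. by case: g_C2 => + _ _; apply. Qed.

Lemma Sminus_segment S x y (t : R) : Sminus S -> 0 <= t <= 1 ->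
  mxinner S (g (x + t *: (y - x))) <= mxinner S (g x) + t * (mxinner S (g y) - mxinner S (g x)).
Proof.
move=> SS /andP[t0 t1].
have h : mxinner S (g (t *: y + (1 - t) *: x)) <=
    t * mxinner S (g y) + (1 - t) * mxinner S (g x).
  by apply: (g_convex SS (Itv01 t0 t1) (x := y) (y := x)); rewrite inE.
have -> : x + t *: (y - x) = t *: y + (1 - t) *: x.
  by rewrite scalerBr scalerBl scale1r addrA [RHS]addrC addrAC.
by apply: le_trans h _; lra.
Qed.

Lemma Sminus_tangent S x y : Sminus S ->
  mxinner S (g x) + mxinner S ('d g x (y - x)) <= mxinner S (g y).
Proof.
move=> SS; rewrite -lerBrDl.
pose D (t : R) : 'M[R]_n := t^-1 *: (g (x + t *: (y - x)) - g x).
have Dc : D @ 0^'+ --> 'd g x (y - x) by exact: diff_quotient_cvg.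
apply: (@cvg_le R R 0^'+ _ (fun t => mxinner S (D t)) (fun=> mxinner S (g y) - mxinner S (g x))).
- by apply: cvg_mxinner => //; exact: cvg_cst.
- exact: cvg_cst.
near=> t.
have t0 : 0 < t by near: t; exact: nbhs_right_gt.
have t1 : t < 1 by near: t; exact: nbhs_right_lt.
rewrite mxinnerZr ler_pdivrMl// mxinnerBr lerBlDl.
by apply: Sminus_segment => //; rewrite !ltW.
Unshelve. all: by end_near. Qed.

Lemma feasible_segment x y (t : R) : feasible A b g x -> feasible A b g y ->
  0 <= t <= 1 -> feasible A b g (x + t *: (y - x)).
Proof.
move=> [Ax gx] [Ay gy] t01; split.
  by rewrite linearD linearZ linearB /= Ax Ay subrr scaler0 addr0.
split=> // u; rewrite quad_mxinner -[mxinner _ _]opprK -mxinnerNl oppr_ge0.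
apply: (le_trans (Sminus_segment x y _ t01)).
  by rewrite /Sminus /= opprK; exact: Splus_rank1.
have [_ /(_ u)] := gx; have [_ /(_ u)] := gy; rewrite !quad_mxinner !mxinnerNl.
by case/andP: t01; nra.
Qed.

(** Entries reduce the matrix-valued g to real functions. *)
Lemma diff_entry x i j :
  differentiable (fun y => g y i j) x /\ forall u, 'd (fun y => g y i j) x u = 'd g x u i j.
Proof.
pose l (M : 'M[R]_n) : R := M i j.
have ll : linear l by move=> a M N; rewrite /l !mxE.
pose L := HB.pack_for {linear 'M[R]_n -> R} l (GRing.isLinear.Build R 'M[R]_n R _ l ll).
have Lc : continuous L by exact: coord_continuous.
have Ld : differentiable L (g x) by exact: linear_differentiable.
have E : (fun y => g y i j) = L \o g by [].
rewrite E; split; first exact: differentiable_comp.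
by move=> u; rewrite diff_comp// diff_lin.
Qed.

Lemma mx_strict_diff T (F : set_system T) (FF : Filter F) (x1 x2 : T -> X) (t : T -> R) x w :
  x1 @ F --> x -> x2 @ F --> x -> (forall k, t k != 0) ->
  (fun k => (t k)^-1 *: (x1 k - x2 k)) @ F --> w ->
  (fun k => (t k)^-1 *: (g (x1 k) - g (x2 k))) @ F --> 'd g x w.
Proof.
move=> x1x x2x t0 wt; apply: cvg_mx => i j.
rewrite -(diff_entry x i j).2.
rewrite (_ : (fun k => _) = fun k => (t k)^-1 * (g (x1 k) i j - g (x2 k) i j)); last first.
  by apply/funext => k; rewrite !mxE.
apply: (@strict_diff _ _ _ _ _ (fun y => g y i j)) => //.
  by apply: nearW => y; exact: (diff_entry y i j).1.
move=> u.
have c : {for x, continuous (fun y => 'd g y u)}.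
  by apply: differentiable_continuous; case: g_C2 => _ + _; apply.
rewrite (_ : (fun y => _) = fun y => 'd g y u i j); last first.
  by apply/funext => y; rewrite (diff_entry y i j).2.
by move: c => /(cvg_entry _ i j); apply.
Qed.

Lemma cvg_mxabs T (F : set_system T) (FF : Filter F) p (f : T -> 'M[R]_p) (M : 'M[R]_p) :
  f @ F --> M -> (fun k => mxabs (f k)) @ F --> mxabs M.
Proof.
move=> fM; apply: cvgD; first exact: cvg_cst.
apply: cvg_big => [|i _]; first exact: add_continuous.
apply: cvg_big => [|j _]; first exact: add_continuous.
by apply: cvg_norm; exact: cvg_entry.
Qed.

End Convexity.

(** * Strong monotonicity on the feasible set *)

Section StrongMonotonicity.
Context {R : realType} {X : euclideanType R} {m n : nat}.
Variables (f : X -> R) (O : set X).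
Variables (A : {linear X -> 'cV[R]_m}) (b : 'cV[R]_m) (g : X -> 'M[R]_n).
Hypothesis (O_open : open O) (f_C2 : C2_on O f).
Hypothesis (g_sym : forall x, g x \is symmetricmx).
Hypothesis (g_C2 : C2_on [set: X] g) (g_convex : Sminus_convex g).
Variables (xs : X) (r0 : R).
Hypothesis (r0_gt0 : 0 < r0) (ball_O : ball xs r0 `<=` O).
Hypothesis (hess_psd : forall x, ball xs r0 x -> forall w, 0 <= inner w (hessian f x w)).
Hypothesis (G_reg : metrically_regular range_norm range_space
  (constraint_map A b g) xs (0, 0)).

Let O_xs : O xs. Proof. by apply: ball_O; exact: ballxx. Qed.

(** The data produced by the failure of a Lipschitz estimate with constant k + 1
    at distance 1 / (k + 1) from the reference point. *)
Record bad_sequences (x1 x2 v1 v2 : nat -> X) : Prop := BadSequences {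
  bad_feas1 : forall k, feasible A b g (x1 k);
  bad_feas2 : forall k, feasible A b g (x2 k);
  bad_x1 : forall k, `|x1 k - xs| < k.+1%:R^-1;
  bad_x2 : forall k, `|x2 k - xs| < k.+1%:R^-1;
  bad_v1 : forall k, `|v1 k| < k.+1%:R^-1;
  bad_v2 : forall k, `|v2 k| < k.+1%:R^-1;
  bad_n1 : forall k, normal_cone (feasible A b g) (x1 k) (v1 k - gradient f (x1 k));
  bad_n2 : forall k, normal_cone (feasible A b g) (x2 k) (v2 k - gradient f (x2 k));
  bad_gap : forall k, k.+1%:R * `|v1 k - v2 k| < `|x1 k - x2 k| }.

(** Put t = |x1 - x2| and let w be the limit of (x1 - x2) / t. With n1, n2 the
    normals at x1, x2, monotonicity of the gradient and of the normal cone
    splits the pairing of v1 - v2 with x1 - x2, which is o(t^2), into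
    nonnegative terms. So each term is o(t^2): for the gradients this gives
    hessian w = 0; for the normals it gives, by concavity of g, that the trace
    of S1 (g x2) is o(t^2) for a multiplier S1 of n1, hence g x2 S1 = o(t) by
    psd_mul_le. Since g x1 S1 = 0, the limit is 'd g w S = 0. *)
Lemma bad_direction x1 x2 v1 v2 : bad_sequences x1 x2 v1 v2 ->
  exists w y S, [/\ `|w| = 1, hessian f xs w = 0, A w = 0, inner (- gradient f xs) w = 0 &
    [/\ multipliers A b g xs (- gradient f xs) (y, S) & 'd g xs w *m S = 0]].
Proof.
move=> [F1 F2 X1 X2 V1 V2 N1 N2 gap].
pose ec (k : nat) : R := k.+1%:R^-1.
have ec0 k : 0 < ec k by rewrite invr_gt0 ltr0n.
have [U [UU UO]] := ultraFilterLemma (eventually_filter : ProperFilter \oo).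
have ecU : ec @ U --> (0 : R).
  by apply: cvg_trans (@cvg_harmonic R); exact: cvg_app.
have small (V : normedModType R) (h : nat -> V) (l : V) :
    (forall k, `|h k - l| < ec k) -> h @ U --> l.
  move=> hl; apply/cvgrPdistC_lt => e e0.
  move/cvgr_lt: ecU => /(_ _ e0); apply: filterS => k; exact: lt_trans.
have x1U : x1 @ U --> xs by exact: small.
have x2U : x2 @ U --> xs by exact: small.
have v1U : v1 @ U --> (0 : X) by apply: small => k; rewrite subr0.
have v2U : v2 @ U --> (0 : X) by apply: small => k; rewrite subr0.
pose t k := `|x1 k - x2 k|.
have t0 k : 0 < t k by apply: le_lt_trans (gap k); rewrite mulr_ge0.
have tn0 k : t k != 0 by rewrite gt_eqF.
have ti0 k : 0 < (t k)^-1 by rewrite invr_gt0.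
have vt k : `|v1 k - v2 k| <= ec k * t k.
  by rewrite /ec ler_pdivlMl ?ltr0n// ltW.
pose wk k := (t k)^-1 *: (x1 k - x2 k).
have wk1 k : `|wk k| = 1.
  by rewrite normrZ gtr0_norm ?invr_gt0// mulVf.
have [w wU] : exists w : X, wk @ U --> w.
  by apply: (@euclid_ultra_cvg _ _ _ _ UU wk 1); apply: nearW => k; rewrite wk1.
have w1 : `|w| = 1.
  apply: (@cvg_near_unique R R _ U _ (fun k => `|wk k|) (fun=> 1)).
  - exact: nearW.
  - exact: cvg_norm.
  - exact: cvg_cst.
pose vs := - gradient f xs.
have grad1 : (fun k => gradient f (x1 k)) @ U --> gradient f xs.
  exact: (@cvg_comp _ _ _ x1 (gradient f) _ _ _ x1U (gradient_cont f_C2 O_xs)).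
have grad2 : (fun k => gradient f (x2 k)) @ U --> gradient f xs.
  exact: (@cvg_comp _ _ _ x2 (gradient f) _ _ _ x2U (gradient_cont f_C2 O_xs)).
pose n1 k := v1 k - gradient f (x1 k); pose n2 k := v2 k - gradient f (x2 k).
have n1U : n1 @ U --> vs by rewrite /vs -[- _]add0r; exact: cvgB.
have n2U : n2 @ U --> vs by rewrite /vs -[- _]add0r; exact: cvgB.
have n1N k : normal_cone (feasible A b g) (x1 k) (n1 k) := N1 k.
have n2N k : normal_cone (feasible A b g) (x2 k) (n2 k) := N2 k.
have n1d k : 0 <= inner (n1 k) (x1 k - x2 k).
  by have := n1N k _ (F2 k); rewrite -[x2 k - x1 k]opprB innerNr oppr_le0.
have n2d k : inner (n2 k) (x1 k - x2 k) <= 0 by exact: n2N.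
have b1 : \forall k \near U, ball xs r0 (x1 k) by apply: x1U; exact: nbhsx_ballx.
have b2 : \forall k \near U, ball xs r0 (x2 k) by apply: x2U; exact: nbhsx_ballx.
pose dg k := gradient f (x1 k) - gradient f (x2 k).
have nE k : n1 k - n2 k = (v1 k - v2 k) - dg k.
  by rewrite /n1 /n2 /dg !opprB addrACA [RHS]addrACA; congr (_ + _); rewrite addrC.
have dgU : \forall k \near U, 0 <= inner (dg k) (x1 k - x2 k).
  near=> k; apply: (@gradient_monotone _ _ O f f_C2 xs r0 ball_O hess_psd); by near: k.
have vd k : inner (v1 k - v2 k) (x1 k - x2 k) <= ec k * t k ^+ 2.
  by apply: le_trans (inner_le _ _) _; rewrite expr2 mulrA ler_wpM2r.
have dgS : (fun k => (t k)^-1 *: dg k) @ U --> hessian f xs w.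
  exact: (gradient_strict O_open f_C2 _ O_xs x1U x2U tn0 wU).
clearbody n1 n2 dg.
have nd k : inner (n1 k) (x1 k - x2 k) - inner (n2 k) (x1 k - x2 k) =
    inner (v1 k - v2 k) (x1 k - x2 k) - inner (dg k) (x1 k - x2 k).
  by rewrite -!innerBl nE.
have dg_le k : inner (dg k) (x1 k - x2 k) <= ec k * t k ^+ 2.
  by move: (nd k) (n1d k) (n2d k) (vd k); lra.
have n1_le : \forall k \near U, inner (n1 k) (x1 k - x2 k) <= ec k * t k ^+ 2.
  by apply: filterS dgU => k; move: (nd k) (n2d k) (vd k); lra.
(* dg and x1 - x2 pair to o(t^2), so the Hessian form vanishes at w. *)
have hw : hessian f xs w = 0.
  apply: (psd_kernel O_open f_C2 O_xs); first by apply: hess_psd; exact: ballxx.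
  apply/eqP; rewrite eq_le; apply/andP; split; last first.
    by rewrite innerC; apply: hess_psd; exact: ballxx.
  apply: (@cvg_le R _ U _ (fun k => inner ((t k)^-1 *: dg k) (wk k)) ec) => //.
    exact: (cvg_inner _ dgS wU).
  apply: nearW => k; rewrite /wk innerZl innerZr mulrA -invfM -expr2.
  by rewrite ler_pdivrMl ?exprn_gt0// mulrC.
have Aw : A w = 0.
  apply: (@cvg_near_unique R _ _ U _ (fun k => A (wk k)) (fun=> 0)).
  - apply: nearW => k; rewrite /wk linearZ linearB /=.
    by have [-> _] := F1 k; have [-> _] := F2 k; rewrite subrr scaler0.
  - exact: cvg_linear.
  - exact: cvg_cst.
have vsw : inner vs w = 0.
  apply/eqP; rewrite eq_le; apply/andP; split.
    apply: (@cvg_le R _ U _ (fun k => inner (n2 k) (wk k)) (fun=> 0)).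
    - exact: cvg_inner.
    - exact: cvg_cst.
    - by apply: nearW => k; rewrite /wk innerZr (pmulr_rle0 _ (ti0 k)); exact: n2d.
  apply: (@cvg_le R _ U _ (fun=> 0) (fun k => inner (n1 k) (wk k))).
  - exact: cvg_cst.
  - exact: cvg_inner.
  - by apply: nearW => k; rewrite /wk innerZr (pmulr_rge0 _ (ti0 k)); exact: n1d.
(* Multipliers exist once x1 is close to xs; the pair (0, 0) fills the
   finitely many other indices. *)
have [rm [C [rm0 C0 Hm]]] := multiplier_bound g_sym g_C2 G_reg.
have /choice[yS ySP] k : exists p : 'cV[R]_m * 'M[R]_n, `|x1 k - xs| < rm ->
  [/\ normal_Splus (g (x1 k)) p.2,
      forall d, inner (n1 k) d = mxinner p.1 (A d) + mxinner p.2 ('d g (x1 k) d),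
      forall i j, `|p.1 i j| <= C * `|n1 k| & forall i j, `|p.2 i j| <= C * `|n1 k|].
  have [h|h] := pselect (`|x1 k - xs| < rm); last by exists (0, 0) => /h.
  by have [y [S P]] := Hm _ h (F1 k) _ (n1N k); exists (y, S).
have near_m : \forall k \near U, `|x1 k - xs| < rm by move/cvgrPdistC_lt: x1U; apply.
have n1b : \forall k \near U, `|n1 k| <= `|vs| + 1.
  have : \forall k \near U, `|vs - n1 k| < 1 by move/cvgrPdist_lt: n1U; apply.
  apply: filterS => k h; have -> : n1 k = vs - (vs - n1 k) by rewrite subKr.
  by apply: le_trans (ler_normB _ _) _; rewrite lerD2l ltW.
have [y yU] : exists y : 'cV[R]_m, (fun k => (yS k).1) @ U --> y.
  apply: (@mx_ultra_cvg _ _ U UU _ _ _ (C * (`|vs| + 1))) => i j.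
  near=> k; have [|_ _ + _] := ySP k; first by near: k.
  by move=> /(_ i j) h; apply: le_trans h _; rewrite ler_wpM2l//; near: k.
have [S SU] : exists S : 'M[R]_n, (fun k => (yS k).2) @ U --> S.
  apply: (@mx_ultra_cvg _ _ U UU _ _ _ (C * (`|vs| + 1))) => i j.
  near=> k; have [|_ _ _] := ySP k; first by near: k.
  by move=> /(_ i j) h; apply: le_trans h _; rewrite ler_wpM2l//; near: k.
have Sn : normal_Splus (g xs) S.
  apply: (@normal_Splus_cvg _ _ _ U _ (fun k => g (x1 k)) (fun k => (yS k).2)) => //.
    by apply: filterS near_m => k /(ySP k)[].
  exact: (C2_cvg g_C2).
have vsE d : inner vs d = mxinner y (A d) + mxinner S ('d g xs d).
  apply: (@cvg_near_unique R R _ U _ (fun k => inner (n1 k) d)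
    (fun k => mxinner (yS k).1 (A d) + mxinner (yS k).2 ('d g (x1 k) d))).
  - by apply: filterS near_m => k /(ySP k)[].
  - by apply: cvg_inner => //; exact: cvg_cst.
  - apply: cvgD; apply: cvg_mxinner => //; first exact: cvg_cst.
    exact: (C2_diff_cvg g_C2).
have vsN : normal_cone (feasible A b g) xs vs.
  move=> x' Fx'.
  apply: (@cvg_le R _ U _ (fun k => inner (n1 k) (x' - x1 k)) (fun=> 0)).
  - by apply: cvg_inner => //; apply: cvgB => //; exact: cvg_cst.
  - exact: cvg_cst.
  - by apply: nearW => k; exact: n1N.
exists w, y, S; split=> //; split.
  split=> //=; apply: inner_ext => d; rewrite innerDl vsE; congr (_ + _).
    rewrite /adjoint rieszP// => a u v.
    by rewrite linearD linearZ /= mxinnerDr mxinnerZr.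
  rewrite /adjoint rieszP// => a u v.
  by rewrite linearD linearZ /= mxinnerDr mxinnerZr.
(* Z tends to the product in question, and its squared entries are O(ec). *)
pose Z k := ((t k)^-1 *: (g (x1 k) - g (x2 k))) *m (yS k).2.
have ZU : Z @ U --> 'd g xs w *m S.
  apply: cvg_mulmx => //; exact: mx_strict_diff.
pose q k := mxabs (g (x2 k)) * mxabs (- (yS k).2) * ec k.
have qU : q @ U --> (0 : R).
  rewrite -(mulr0 (mxabs (g xs) * mxabs (- S))); apply: cvgM => //.
  by apply: cvgM; apply: cvg_mxabs; [exact: (C2_cvg g_C2)|exact: cvgN].
suff Z0 : Z @ U --> (0 : 'M[R]_n).
  by apply: (@cvg_near_unique R _ _ U _ Z Z) => //; exact: nearW.
apply: cvg_mx => i j; rewrite mxE.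
apply: (@sqr_cvg0 R _ U _ _ _ _ q) => //.
near=> k; rewrite subr0 real_normK ?num_real//.
apply: le_trans (sqr_le_mxinner (Z k) i j) _.
have [|Sk nk _ _] := ySP k; first by near: k.
have g1 : Splus (g (x1 k)) by have [] := F1 k.
have g2 : Splus (g (x2 k)) by have [] := F2 k.
have SkS := normal_Sminus g1 Sk.
have [Sk0 Skle] := normal_SplusP g1 Sk.
have ZE : Z k = (t k)^-1 *: (g (x2 k) *m (- (yS k).2)).
  by rewrite /Z -scalemxAl mulmxBl (normal_mul0 g1 Sk) sub0r mulmxN.
rewrite ZE mxinnerZl mxinnerZr mulrA -invfM -expr2.
rewrite ler_pdivrMl ?exprn_gt0//.
apply: le_trans (psd_mul_le g2 SkS _) _.
  by move=> M' M'S; rewrite mxinnerNl oppr_ge0 Skle.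
rewrite /q [leRHS]mulrC -[leRHS]mulrA ler_wpM2l ?mulr_ge0 ?(ltW (mxabs_gt0 _))//.
have n1k : inner (n1 k) (x1 k - x2 k) <= ec k * t k ^+ 2 by near: k.
apply: le_trans n1k; rewrite mxinnerNl.
have A0 : A (x2 k - x1 k) = 0.
  by rewrite linearB; case: (F1 k) => -> _; case: (F2 k) => -> _; rewrite subrr.
have E := nk (x2 k - x1 k); rewrite A0 mxinner0r add0r in E.
have := Sminus_tangent g_C2 g_convex (x1 k) (x2 k) SkS.
by rewrite Sk0 add0r -E -[x2 k - x1 k]opprB innerNr lerNl.
Unshelve. all: by end_near. Qed.

(** The inverse of the set-valued map gradient f + N, where N is the normal cone
    of the feasible set, is at most single valued and Lipschitz near xs:
    otherwise bad_direction produces a unit vector excluded by the hypothesis. *)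
Lemma strong_monotonicity :
  (forall w y S, multipliers A b g xs (- gradient f xs) (y, S) ->
    hessian f xs w = 0 -> A w = 0 -> inner (- gradient f xs) w = 0 ->
    'd g xs w *m S = 0 -> w = 0) ->
  exists eps L : R, [/\ 0 < eps, 0 < L &
    forall x1 x2 v1 v2, feasible A b g x1 -> feasible A b g x2 ->
      `|x1 - xs| < eps -> `|x2 - xs| < eps -> `|v1| < eps -> `|v2| < eps ->
      normal_cone (feasible A b g) x1 (v1 - gradient f x1) ->
      normal_cone (feasible A b g) x2 (v2 - gradient f x2) ->
      `|x1 - x2| <= L * `|v1 - v2|].
Proof.
move=> ker0; apply: contrapT => H.
have /choice[s sP] (k : nat) : exists s : (X * X) * (X * X),
    [/\ feasible A b g s.1.1 /\ feasible A b g s.1.2,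
        `|s.1.1 - xs| < k.+1%:R^-1 /\ `|s.1.2 - xs| < k.+1%:R^-1,
        `|s.2.1| < k.+1%:R^-1 /\ `|s.2.2| < k.+1%:R^-1,
        normal_cone (feasible A b g) s.1.1 (s.2.1 - gradient f s.1.1) /\
        normal_cone (feasible A b g) s.1.2 (s.2.2 - gradient f s.1.2)
      & k.+1%:R * `|s.2.1 - s.2.2| < `|s.1.1 - s.1.2|].
  apply: contrapT => Hk; apply: H; exists (k.+1%:R^-1), k.+1%:R.
  split; [by rewrite invr_gt0 ltr0n|by rewrite ltr0n|].
  move=> x1 x2 v1 v2 f1 f2 h1 h2 h3 h4 h5 h6; rewrite leNgt; apply/negP => h7.
  by apply: Hk; exists ((x1, x2), (v1, v2)).
have bad : bad_sequences (fun k => (s k).1.1) (fun k => (s k).1.2)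
    (fun k => (s k).2.1) (fun k => (s k).2.2).
  by split=> k; have [[? ?] [? ?] [? ?] [? ?] ?] := sP k.
have [w [y [S [w1 hw Aw vw [Sm DS]]]]] := bad_direction bad.
by move: w1; rewrite (ker0 w y S)// normr0 => /eqP; rewrite eq_sym oner_eq0.
Qed.

End StrongMonotonicity.

(** * Tilt stability *)

Section TiltStability.
Context {R : realType} {X : euclideanType R} {m n : nat}.
Variables (phi : X -> \bar R) (O : set X).
Variables (A : {linear X -> 'cV[R]_m}) (b : 'cV[R]_m) (g : X -> 'M[R]_n).
Hypothesis (feasible_O : feasible A b g `<=` O).
Hypothesis (phi_proper : proper_fun phi).
Hypothesis (phi_fin : forall x, O x -> phi x \is a fin_num).
Let f (x : X) : R := fine (phi x).
Hypothesis (f_C2 : C2_on O f).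
Hypothesis (g_sym : forall x, g x \is symmetricmx).
Hypothesis (g_C2 : C2_on [set: X] g) (g_convex : Sminus_convex g).
Let Gamma := feasible A b g.
Let obj x := (phi x + set_indicator Gamma x)%E.

Let f_diff x : O x -> differentiable f x. Proof. by case: f_C2 => + _ _; apply. Qed.

Lemma obj_feasible x : Gamma x -> obj x = (f x)%:E.
Proof.
move=> Gx; rewrite /obj /set_indicator mem_set// adde0 fineK// phi_fin//.
exact: feasible_O.
Qed.

Lemma obj_infeasible x : ~ Gamma x -> obj x = +oo%E.
Proof.
move=> Gx; rewrite /obj /set_indicator memNset// addey//.
by case: phi_proper.
Qed.

Lemma tilted_argminP xs delta v x : 0 < delta -> Gamma xs ->
  tilted_argmin obj xs delta v x <->
  [/\ `|x - xs| <= delta, Gamma x &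
    forall z, `|z - xs| <= delta -> Gamma z -> f x - inner v x <= f z - inner v z].
Proof.
move=> d0 Gxs; rewrite /tilted_argmin /= closed_ballE// /closed_ball_ /=.
have hE z : Gamma z -> (obj z - obj xs - (inner v (z - xs))%:E)%E =
    (f z - f xs - inner v (z - xs))%:E.
  by move=> Gz; rewrite !obj_feasible// -!EFinB.
have hN z : ~ Gamma z -> (obj z - obj xs - (inner v (z - xs))%:E)%E = +oo%E.
  by move=> Gz; rewrite obj_infeasible// obj_feasible.
split.
  move=> [xb xm].
  have Gx : Gamma x.
    have xx : `|xs - xs| <= delta by rewrite subrr normr0 ltW.
    by apply: contrapT => /hN E; have := xm xs xx; rewrite E hE// leye_eq.
  split=> //; first by rewrite distrC.
  move=> z zb Gz; have := xm z; rewrite distrC => /(_ zb).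
  by rewrite !hE// lee_fin !innerBr; lra.
move=> [xb Gx xm]; split; first by rewrite distrC.
move=> z; rewrite distrC => zb; have [Gz|Gz] := pselect (Gamma z); last first.
  by rewrite (hN z)// leey.
by rewrite !hE// lee_fin !innerBr; have := xm z zb Gz; lra.
Qed.

(** The feasible set is convex, so every feasible direction can be followed. *)
Lemma stationary (v x : X) (rho : R) : 0 < rho -> Gamma x ->
  (forall z, Gamma z -> `|z - x| < rho -> f x - inner v x <= f z - inner v z) ->
  normal_cone Gamma x (v - gradient f x).
Proof.
move=> rho0 Gx xm z Gz; rewrite innerBl gradientP subr_le0.
have d1 : 0 < `|z - x| + 1 by rewrite ltr_wpDl.
apply: (@diff_ge _ _ _ _ _ (Num.min 1 (rho / (`|z - x| + 1)))).
- by apply: f_diff; exact: feasible_O.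
- by rewrite lt_min ltr01 divr_gt0.
move=> t /andP[t0]; rewrite lt_min => /andP[t1]; rewrite ltr_pdivlMr// => td.
have Gt : Gamma (x + t *: (z - x)).
  by apply: (feasible_segment g_sym g_convex) => //; rewrite !ltW.
have := xm _ Gt; rewrite [x + _ - x]addrAC subrr add0r normrZ gtr0_norm//.
have -> : t * `|z - x| < rho.
  by apply: le_lt_trans td; rewrite ler_pM2l// lerDl.
by move=> /(_ isT); rewrite innerDr innerZr; lra.
Qed.

Lemma feasible_ball_compact (xs : X) (delta : R) (C : set X) : limit_closed C ->
  compact [set x | [/\ `|x - xs| <= delta, Gamma x & C x]].
Proof.
move=> Cc; apply: (@euclid_compact _ _ _ (delta + `|xs|)) => [F FF FK l Fl|x [xb _ _]].
  split.
  - apply: (@cvg_le R X F _ (fun u => `|u - xs|) (fun=> delta)) => //.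
    + by apply: cvg_norm; apply: cvgB => //; exact: cvg_cst.
    + exact: cvg_cst.
    + by apply: filterS FK => ? [].
  - split.
      apply: (@cvg_near_unique R _ X F _ A (fun=> b)).
      + by apply: filterS FK => ? [_ []].
      + exact: (@cvg_linear _ _ _ F _ _ _ A id).
      + exact: cvg_cst.
    apply: (@Splus_closed_cvg _ _ _ F _ g).
      by apply: filterS FK => ? [_ []].
    have gc : {for l, continuous g}.
      by apply: differentiable_continuous; case: g_C2 => + _ _; apply.
    exact: (@cvg_comp _ _ _ id g _ _ _ Fl gc).
  - by apply: (Cc F) => //; apply: filterS FK => ? [].
by rewrite -[x](subrK xs); apply: le_trans (ler_normD _ _) _; rewrite lerD2r.
Qed.

Lemma tilt_min_exists (xs : X) (delta : R) (C : set X) (v : X) : limit_closed C ->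
  (exists x, [/\ `|x - xs| <= delta, Gamma x & C x]) ->
  exists x, [/\ `|x - xs| <= delta, Gamma x, C x &
    forall z, `|z - xs| <= delta -> Gamma z -> C z -> f x - inner v x <= f z - inner v z].
Proof.
move=> Cc ne.
have [|x] := compact_EVT_min (f := fun x => f x - inner v x) ne (feasible_ball_compact Cc (delta := delta)).
  apply: continuous_in_subspaceT => x; rewrite inE => -[_ Gx _].
  apply: cvgB; last by apply: cvg_inner; [exact: cvg_cst|exact: cvg_id].
  by apply: differentiable_continuous; apply: f_diff; exact: feasible_O.
rewrite inE => -[xb Gx Cx] xm; exists x; split => // z zb Gz Cz.
by apply: xm; rewrite inE.
Qed.

(** Stationary points of the tilted problems depend on the tilt in a single
    valued and Lipschitz way near xs. Convexity makes xs a minimizer on a whole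
    ball, hence the only one; minimizers for small tilts exist by compactness
    and stay off the boundary sphere, where f exceeds f xs by a fixed amount,
    so they are stationary. *)
Lemma tilt_stable_of_strong_monotonicity (xs : X) (r0 eps L : R) :
  Gamma xs -> 0 < r0 -> ball xs r0 `<=` O ->
  (forall x, ball xs r0 x -> forall w, 0 <= inner w (hessian f x w)) ->
  normal_cone Gamma xs (- gradient f xs) ->
  0 < eps -> 0 < L ->
  (forall x1 x2 v1 v2, Gamma x1 -> Gamma x2 ->
      `|x1 - xs| < eps -> `|x2 - xs| < eps -> `|v1| < eps -> `|v2| < eps ->
      normal_cone Gamma x1 (v1 - gradient f x1) ->
      normal_cone Gamma x2 (v2 - gradient f x2) ->
      `|x1 - x2| <= L * `|v1 - v2|) ->
  tilt_stable obj xs.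
Proof.
move=> Gxs r00 r0O psd xsN eps0 L0 star.
have xs_min z : Gamma z -> `|z - xs| < r0 -> f xs <= f z.
  move=> Gz zr; have bz : ball xs r0 z by rewrite -ball_normE /= distrC.
  have := gradient_convex f_C2 r0O psd bz (ballxx xs r00).
  by have := xsN z Gz; rewrite innerNl; lra.
pose e := Num.min eps r0; pose delta := e / 2.
have e0 : 0 < e by rewrite lt_min eps0.
have d0 : 0 < delta by rewrite divr_gt0.
have de : delta < eps by rewrite (@lt_le_trans _ _ e)// ?ge_min ?lexx// /delta; lra.
have dr : delta < r0 by rewrite (@lt_le_trans _ _ e)// ?ge_min ?lexx ?orbT// /delta; lra.
have min_unique x : `|x - xs| <= delta -> Gamma x -> f x <= f xs -> x = xs.
  move=> xd Gx fx; apply/eqP; rewrite -subr_eq0 -normr_le0.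
  have xN : normal_cone Gamma x (0 - gradient f x).
    apply: (@stationary _ _ (r0 - delta)) => //; first by rewrite subr_gt0.
    move=> z Gz zx; rewrite !inner0l !subr0; apply: (le_trans fx); apply: xs_min => //.
    rewrite -(subrK x z) -addrA; apply: le_lt_trans (ler_normD _ _) _; lra.
  have := star x xs 0 0 Gx Gxs; rewrite !subrr !normr0 mulr0; apply => //.
  - exact: le_lt_trans xd de.
  - by rewrite sub0r.
split.
- split; last by exists xs; rewrite obj_feasible// ltry.
  move=> x; have [Gx|Gx] := pselect (Gamma x); first by rewrite obj_feasible.
  by rewrite obj_infeasible.
- by rewrite obj_feasible// ltry.
exists delta; split=> //.
  apply/seteqP; split=> x /=.
    move=> /(tilted_argminP _ _ d0 Gxs)[xd Gx /(_ xs)].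
    rewrite subrr normr0 !inner0l !subr0 => /(_ (ltW d0) Gxs); exact: min_unique.
  move=> ->; apply/(tilted_argminP _ _ d0 Gxs).
  rewrite subrr normr0 !inner0l; split=> //; first exact: ltW.
  move=> z zd Gz; rewrite inner0l !subr0; apply: xs_min => //.
  exact: le_lt_trans zd dr.
(* On the part C of the ball at distance delta, f exceeds f xs by a fixed
   amount, which a small tilt cannot compensate. *)
have [rho [rho0 rhoe rhoP]] : exists rho : R, [/\ 0 < rho, rho <= eps &
    forall v x, `|v| < rho -> tilted_argmin obj xs delta v x -> `|x - xs| < delta].
  pose C := [set x : X | delta <= `|x - xs|].
  have Cc : limit_closed C.
    move=> F FF FC l Fl; apply: (@cvg_le R X F _ (fun=> delta) (fun u => `|u - xs|)) => //.
      exact: cvg_cst.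
    by apply: cvg_norm; apply: cvgB => //; exact: cvg_cst.
  have [ne|em] := pselect (exists x, [/\ `|x - xs| <= delta, Gamma x & C x]).
    have [x0 [x0d Gx0 Cx0 x0m]] := tilt_min_exists 0 Cc ne.
    have fx0 : f xs < f x0.
      rewrite ltNge; apply/negP => /(min_unique x0 x0d Gx0) E.
      by move: Cx0; rewrite /C /= E subrr normr0 leNgt d0.
    exists (Num.min eps ((f x0 - f xs) / delta)); split.
    - by rewrite lt_min eps0 divr_gt0// subr_gt0.
    - by rewrite ge_min lexx.
    move=> v x; rewrite lt_min => /andP[_]; rewrite ltr_pdivlMr// => vd.
    move=> /(tilted_argminP _ _ d0 Gxs)[xd Gx /(_ xs)].
    rewrite subrr normr0 => /(_ (ltW d0) Gxs) xm; rewrite ltNge; apply/negP => xC.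
    have := x0m x xd Gx xC; rewrite !inner0l !subr0 => fx.
    have : inner v (x - xs) <= `|v| * delta.
      by apply: le_trans (inner_le _ _) _; rewrite ler_wpM2l.
    by rewrite innerBr; move: xm vd fx; lra.
  exists eps; split=> // v x _ /(tilted_argminP _ _ d0 Gxs)[xd Gx _].
  by rewrite ltNge; apply/negP => xC; apply: em; exists x.
have arg_stat v x : `|v| < rho -> tilted_argmin obj xs delta v x ->
    [/\ Gamma x, `|x - xs| < eps & normal_cone Gamma x (v - gradient f x)].
  move=> vr xm; have xd := rhoP v x vr xm.
  have [_ Gx xm'] := (tilted_argminP _ _ d0 Gxs).1 xm.
  split=> //; first exact: lt_trans xd de.
  apply: (@stationary _ _ (delta - `|x - xs|)) => //; first by rewrite subr_gt0.
  move=> z Gz zx; apply: xm' => //.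
  rewrite -(subrK x z) -addrA; apply: le_trans (ler_normD _ _) _; lra.
have arg_lip v1 v2 x1 x2 : `|v1| < rho -> `|v2| < rho ->
    tilted_argmin obj xs delta v1 x1 -> tilted_argmin obj xs delta v2 x2 ->
    `|x1 - x2| <= L * `|v1 - v2|.
  move=> h1 h2 /(arg_stat _ _ h1)[G1 b1 N1] /(arg_stat _ _ h2)[G2 b2 N2].
  by apply: star => //; exact: lt_le_trans rhoe.
have /choice[M MP] v : exists x, `|v| < rho -> tilted_argmin obj xs delta v x.
  have [x [xd Gx _ xm]] : exists x, [/\ `|x - xs| <= delta, Gamma x, setT x &
      forall z, `|z - xs| <= delta -> Gamma z -> setT z -> f x - inner v x <= f z - inner v z].
    apply: tilt_min_exists => //; exists xs.
    by rewrite subrr normr0; split=> //; exact: ltW.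
  by exists x => _; apply/(tilted_argminP _ _ d0 Gxs); split=> // z zd Gz; exact: xm.
exists [set v | `|v| < rho], M, L; split.
- apply/nbhs_ballP; exists rho => //= v; rewrite -ball_normE /= sub0r normrN.
  by [].
- move=> v /= vr; apply/seteqP; split=> x /=; last by move=> ->; exact: MP.
  move=> xm; apply/eqP; rewrite -subr_eq0 -normr_le0.
  by have := arg_lip v v x (M v) vr vr xm (MP v vr); rewrite subrr normr0 mulr0.
- by move=> [v1 v2] /= [h1 h2]; apply: arg_lip => //; exact: MP.
Qed.

End TiltStability.

Theorem theorem3p1 (R : realType) (X : euclideanType R) (m n : nat)
    (phi : X -> \bar R) (O : set X)
    (A : {linear X -> 'cV[R]_m}) (b : 'cV[R]_m) (g : X -> 'M[R]_n)
    (phi_proper : proper_fun phi) (phi_lsc : lower_semicontinuous phi)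
    (O_open : open O) (feasible_O : feasible A b g `<=` O)
    (phi_fin : forall x, O x -> phi x \is a fin_num)
    (phi_C2 : C2_on O (fun x => fine (phi x) : R))
    (g_sym : forall x, g x \is symmetricmx)
    (g_C2 : C2_on [set: X] g) (g_convex : Sminus_convex g)
    (xs : X) (xs_sol : local_solution phi A b g xs)
    (N : set X) (N_open : open N) (N_xs : N xs) (N_O : N `<=` O)
    (hess_psd : forall x, N x -> forall w : X,
       0 <= inner w (hessian (fun z => fine (phi z)) x w))
    (G_reg : metrically_regular range_norm range_space (constraint_map A b g)
       xs (0, 0))
    (ys : 'cV[R]_m) (Ss : 'M[R]_n) :
  let vs := - gradient (fun z => fine (phi z)) xs in
  min_rank_multiplier A b g xs vs ys Ss ->
  [set w : X | hessian (fun z => fine (phi z)) xs w = 0]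
    `&` [set w : X | A w = 0]
    `&` [set w : X | inner vs w = 0]
    `&` Upsilon g xs Ss = [set 0] ->
  tilt_stable (fun x => phi x + set_indicator (feasible A b g) x)%E xs.
Proof.
move=> vs [[_ /= nS _] rk_min] ker0.
have [xs_feas xs_min] := xs_sol.
have gxs : Splus (g xs) by case: xs_feas.
have [r0 /= r00 r0N] : exists2 r0 : R, 0 < r0 & ball xs r0 `<=` N.
  by have /nbhs_ballP[r0] := open_nbhs_nbhs (conj N_open N_xs); exists r0.
have r0O : ball xs r0 `<=` O by exact: subset_trans N_O.
have psd x : ball xs r0 x -> forall w, 0 <= inner w (hessian (fun z => fine (phi z)) x w).
  by move=> /r0N; exact: hess_psd.
have [|eps [L [eps0 L0 star]]] := @strong_monotonicity R X m n (fun z => fine (phi z))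
    O A b g O_open phi_C2 g_sym g_C2 g_convex xs r0 r00 r0O psd G_reg.
  move=> w y S /[dup] mS [_ nS' _] hw Aw vw DS.
  suff : [set 0] w by [].
  rewrite -ker0; split; first by split; [split|].
  by apply: (in_Upsilon gxs nS nS' _ DS); exact: rk_min mS.
apply: (tilt_stable_of_strong_monotonicity feasible_O phi_proper phi_fin phi_C2
  g_sym g_C2 g_convex xs_feas r00 r0O psd _ eps0 L0 star).
have [rho /= rho0 rhoP] : exists2 rho : R, 0 < rho &
    ball xs rho `<=` [set z | feasible A b g z -> (phi xs <= phi z)%E].
  by have /nbhs_ballP[rho] := xs_min; exists rho.
rewrite -[- _]add0r; apply: (stationary feasible_O phi_C2 g_sym g_convex rho0) => //.
move=> z Gz zx; rewrite !inner0l !subr0.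
have zb : ball xs rho z by rewrite -ball_normE /= distrC.
by apply: fine_le (rhoP z zb Gz); apply: phi_fin; exact: feasible_O.
Qed.
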